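(* Up to isomorphism there are twelve simply connected 2-step nilpotent Lie groups of dimension at most $6$. The simply connected Lie group $N_6$ whose Lie algebra is $\mathcal{N}_6$ (a 6-dimensional 2-step nilpotent Lie group) does not satisfy the partial automatic continuity, and each of the other eleven simply connected 2-step nilpotent Lie groups of dimension at most $6$ satisfies the partial automatic continuity.
   Context: $\mathcal{N}_6=\mathrm{heis}_3(\mathbb{R}[\epsilon])$, where $\mathbb{R}[\epsilon]=\mathbb{R}[X]/(X^2)$ is the ring of dual numbers; concretely, $\mathcal{N}_6$ is the real Lie algebra with basis $X_1,X_2,X_3,X_4,Z_1,Z_2$ and nonzero brackets (up to antisymmetry) $[X_1,X_2]=Z_1$, $[X_1,X_3]=Z_2$, $[X_2,X_4]=Z_2$. A Lie group is 2-step nilpotent if $[N,N]\neq 1$ is central. For a simply connected nilpotent Lie group $N$ with Lie algebra $\mathcal{N}$ ($\exp$ a diffeomorphism): a central automorphism is an abstract group automorphism $F$ with $x^{-1}F(x)\in Z(N)$ for all $x$; a Lie group automorphism is a continuous automorphism. Field automorphisms: if $\mathcal{N}=\mathcal{N}_1\oplus\cdots\oplus\mathcal{N}_k$ is a direct sum of ideals, for each $\mathcal{N}_i$ that is the realification of a complex Lie algebra choose a $\mathbb{C}$-basis $e_1,\dots,e_m$ and a field automorphism $\varphi$ of $\mathbb{C}$ fixing the structure constants in this basis and set $\sigma_i(\sum x_le_l)=\sum\varphi(x_l)e_l$; otherwise $\sigma_i=\mathrm{id}$; then $\exp\circ(\sigma_1\times\cdots\times\sigma_k)\circ\exp^{-1}$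 is a field automorphism of $N$. $N$ satisfies the partial automatic continuity if every abstract group automorphism $F$ of $N$ has the form $F=\mu\circ\overline{F}\circ\Phi$ with $\mu$ central, $\overline{F}$ a Lie group automorphism and $\Phi$ a field automorphism. *)

(* Defs.v *)
From HB Require Import structures.
From mathcomp Require Import all_boot all_order all_algebra.
From mathcomp Require Import all_classical all_reals all_analysis.
From mathcomp Require Import complex.
Import numFieldNormedType.Exports.
Set Implicit Arguments. Unset Strict Implicit. Unset Printing Implicit Defensive.
Import Order.TTheory GRing.Theory Num.Theory.
Local Open Scope ring_scope.

(* A real Lie algebra of dimension n is modelled on the space 'rV[R]_n of row
   vectors (any n-dimensional real Lie algebra is isomorphic to one of these),
   with a bracket  br : 'rV_n -> 'rV_n -> 'rV_n. *)

Section Defs.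
Variable R : realType.
Local Notation V n := 'rV[R]_n.

Definition lie_bracket n (br : V n -> V n -> V n) : Prop :=
  [/\ (forall (a : R) x y z, br (a *: x + y) z = a *: br x z + br y z),
      (forall (a : R) x y z, br x (a *: y + z) = a *: br x y + br x z),
      (forall x, br x x = 0) &
      (forall x y z, br x (br y z) + br y (br z x) + br z (br x y) = 0)].

Definition two_step n (br : V n -> V n -> V n) : Prop :=
  [/\ lie_bracket br,
      (exists x y, br x y <> 0) &
      (forall x y z, br (br x y) z = 0)].

Definition lie_iso n m (br : V n -> V n -> V n) (br' : V m -> V m -> V m) : Prop :=
  exists f : V n -> V m,
    [/\ (forall (a : R) x y, f (a *: x + y) = a *: f x + f y),
        bijective f &
        (forall x y, f (br x y) = br' (f x) (f y))].

(* The simply connected nilpotent Lie group N with Lie algebra (V n, br),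
   transported to V n via exp : (V n) -> N (a diffeomorphism). For a 2-step
   nilpotent Lie algebra the Baker-Campbell-Hausdorff formula gives the
   product  exp x exp y = exp (x + y + 1/2 [x,y]); exp 0 = 1, exp(-x) = (exp x)^-1. *)
Definition gmul n (br : V n -> V n -> V n) (x y : V n) : V n :=
  x + y + 2^-1 *: br x y.
Definition ginv n (x : V n) : V n := - x.

Definition group_aut n (br : V n -> V n -> V n) (F : V n -> V n) : Prop :=
  bijective F /\ forall x y, F (gmul br x y) = gmul br (F x) (F y).

Definition in_center n (br : V n -> V n -> V n) (z : V n) : Prop :=
  forall x, gmul br z x = gmul br x z.

Definition central_aut n (br : V n -> V n -> V n) (F : V n -> V n) : Prop :=
  group_aut br F /\ forall x, in_center br (gmul br (ginv x) (F x)).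

Definition lie_group_aut n (br : V n -> V n -> V n) (F : V n -> V n) : Prop :=
  group_aut br F /\ continuous F.

Definition cbracket m (c : 'I_m -> 'I_m -> 'rV[R[i]]_m) (z w : 'rV[R[i]]_m)
  : 'rV[R[i]]_m :=
  \sum_(l < m) \sum_(j < m) (z 0 l * w 0 j) *: c l j.

(* sig : V n -> V n acts on the ideal W (a subspace, given as a row space) as
   a "complex field automorphism": W is (via psi) the realification of the
   complex Lie algebra C^m with structure constants c in the C-basis
   psi(e_1),...,psi(e_m), phi is a field automorphism of C fixing all the
   structure constants, and sig (sum_l x_l e_l) = sum_l phi(x_l) e_l. *)
Definition complex_twist n (br : V n -> V n -> V n) (W : 'M[R]_n)
    (sig : V n -> V n) : Prop :=
  exists (m : nat) (c : 'I_m -> 'I_m -> 'rV[R[i]]_m)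
         (psi : 'rV[R[i]]_m -> V n) (phi : {rmorphism R[i] -> R[i]}),
    [/\
        (forall (a : R) z w, psi ((a%:C)%C *: z + w) = a *: psi z + psi w),
        injective psi,
        (forall z, (psi z <= W)%MS),
        (forall v, (v <= W)%MS -> exists z, psi z = v) &
    [/\
        (forall z w, psi (cbracket c z w) = br (psi z) (psi w)),
        bijective phi,
        (forall l j k, phi (c l j 0 k) = c l j 0 k) &
        (forall z, sig (psi z) = psi (map_mx phi z))]].

(* Field automorphisms of N: N = N_1 (+) ... (+) N_k a direct sum of ideals,
   sigma_i = id on N_i, or a complex twist if N_i is the realification of a
   complex Lie algebra; Phi = sigma_1 x ... x sigma_k (exp is the identity in
   our model). *)
Definition field_aut n (br : V n -> V n -> V n) (Phi : V n -> V n) : Prop :=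
  exists (k : nat) (W : 'I_k -> 'M[R]_n) (sig : 'I_k -> V n -> V n),
    [/\
        mxdirect (\sum_(i < k) W i),
        (\sum_(i < k) W i :=: 1%:M)%MS,
        (forall i x v, (v <= W i)%MS -> (br x v <= W i)%MS),
        (forall i, (forall v, (v <= W i)%MS -> sig i v = v)
                   \/ complex_twist br (W i) (sig i)) &
        (forall (u : 'I_k -> V n), (forall i, (u i <= W i)%MS) ->
           Phi (\sum_(i < k) u i) = \sum_(i < k) sig i (u i))].

Definition partial_auto_cont n (br : V n -> V n -> V n) : Prop :=
  forall F, group_aut br F ->
    exists mu Fb Phi, [/\ central_aut br mu, lie_group_aut br Fb,
                          field_aut br Phi &
                          forall x, F x = mu (Fb (Phi x))].

(* N_6 = heis_3(R[eps]): basis X1..X4 (indices 0..3), Z1 (4), Z2 (5);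
   [X1,X2]=Z1, [X1,X3]=Z2, [X2,X4]=Z2. *)
Definition n6_br (x y : V 6) : V 6 :=
  let c (i : nat) (v : V 6) := v 0 (inord i) in
  (c 0 x * c 1 y - c 1 x * c 0 y) *: delta_mx 0 (inord 4)
  + (c 0 x * c 2 y - c 2 x * c 0 y + c 1 x * c 3 y - c 3 x * c 1 y)
      *: delta_mx 0 (inord 5).

End Defs.

(* Main.v *)
Require Import Defs.
From HB Require Import structures.
From mathcomp Require Import all_boot all_order all_algebra.
From mathcomp Require Import all_classical all_reals all_analysis.
From mathcomp Require Import complex.
From mathcomp Require Import ring lra zify.
Import numFieldNormedType.Exports.
Import Order.TTheory GRing.Theory Num.Theory.
Set Implicit Arguments. Unset Strict Implicit. Unset Printing Implicit Defensive.
Local Open Scope ring_scope.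

(** In exponential coordinates a group automorphism of a 2-step nilpotent group
    is an additive bijection [F] of the Lie algebra that preserves the bracket.
    If [F] is real linear modulo the center, it is a central automorphism
    composed with a Lie automorphism.

    For an element [x] whose double centralizer is [R x + Z], the maps
    [F^-1 o a o F] act on [x] modulo [Z] by a scalar [phi a], and comparing with
    a second such element that does not commute with [x] shows that [phi] is a
    ring endomorphism of [R], hence the identity. Outside [N_6] and the complex
    Heisenberg algebra such elements span the algebra modulo its center. The
    complex Heisenberg algebra gives in the same way a field automorphism [phi]
    of [C] in place of the identity.

    In [N_6], the Heisenberg algebra over the dual numbers, the automorphism of
    the dual numbers [a + b eps |-> a + (b + D a) eps] attached to a nonzero
    derivation [D] of [R] induces a group automorphism that is not real linear
    modulo the center, while every field automorphism of [N_6] is the identity: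
    [N_6] is indecomposable and carries no complex structure. The derivation is
    obtained by Zorn's lemma from a transcendental number.

    The classification splits on the codimension of the center. The case of
    codimension 4 and a center of dimension 2 splits on the existence of a
    noncentral [x] such that [ad x] has rank one; without such an [x] the bracket
    is complex bilinear for a suitable complex structure. *)

(** * Lie ring automorphisms *)

(** Only the action modulo the center has to be controlled: adding to [x] the value at [x] of any
    additive map into the center that vanishes on the center is a central automorphism, however
    discontinuous. The obstacle is that [F] is additive but not homogeneous. The scalar by which
    F^-1 o a o F acts on [x] could change when [x] is replaced by a real multiple, and then phi need
    not be multiplicative. A noncommuting partner with a small double centralizer pins the scalar
    down for all multiples at once. N_6 has no such pair. If [x] is not a multiple of eps modulo the
    center, its double centralizer also contains eps x, so a scalar there is a dual number and
    leaves room for a derivation. The elements with a small double centralizer are multiples of eps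
    modulo the center, and these commute with each other. *)

Section Bracket.
Variables (R : realType) (n : nat) (br : 'rV[R]_n -> 'rV[R]_n -> 'rV[R]_n).
Hypothesis Hbr : two_step br.

Lemma brP_l a x y z : br (a *: x + y) z = a *: br x z + br y z.
Proof. by case: Hbr => -[]. Qed.

Lemma brP_r a x y z : br x (a *: y + z) = a *: br x y + br x z.
Proof. by case: Hbr => -[]. Qed.

Lemma br_alt x : br x x = 0.
Proof. by case: Hbr => -[]. Qed.

Lemma br_brl x y z : br (br x y) z = 0.
Proof. by case: Hbr. Qed.

Lemma br0l x : br 0 x = 0.
Proof. by have := brP_l (-1) 0 0 x; rewrite scaler0 addr0 scaleN1r addNr. Qed.

Lemma br0r x : br x 0 = 0.
Proof. by have := brP_r (-1) x 0 0; rewrite scaler0 addr0 scaleN1r addNr. Qed.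

Lemma brDl x y z : br (x + y) z = br x z + br y z.
Proof. by have := brP_l 1 x y z; rewrite !scale1r. Qed.

Lemma brDr x y z : br x (y + z) = br x y + br x z.
Proof. by have := brP_r 1 x y z; rewrite !scale1r. Qed.

Lemma brZl a x y : br (a *: x) y = a *: br x y.
Proof. by have := brP_l a x 0 y; rewrite !addr0 br0l addr0. Qed.

Lemma brZr a x y : br x (a *: y) = a *: br x y.
Proof. by have := brP_r a x y 0; rewrite !addr0 br0r addr0. Qed.

Lemma brNl x y : br (- x) y = - br x y.
Proof. by rewrite -scaleN1r brZl scaleN1r. Qed.

Lemma brNr x y : br x (- y) = - br x y.
Proof. by rewrite -scaleN1r brZr scaleN1r. Qed.

Lemma brBr x y z : br x (y - z) = br x y - br x z.
Proof. by rewrite brDr brNr. Qed.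

Lemma brC x y : br y x = - br x y.
Proof.
apply/eqP; rewrite -addr_eq0 addrC; apply/eqP.
by have := br_alt (x + y); rewrite brDl !brDr !br_alt add0r addr0.
Qed.

Lemma br_brr x y z : br z (br x y) = 0.
Proof. by rewrite brC br_brl oppr0. Qed.

Lemma br_suml (I : Type) (r : seq I) (f : I -> 'rV[R]_n) y :
  br (\sum_(i <- r) f i) y = \sum_(i <- r) br (f i) y.
Proof.
elim: r => [|i r IH]; first by rewrite !big_nil br0l.
by rewrite !big_cons brDl IH.
Qed.

Lemma br_sumr (I : Type) (r : seq I) (f : I -> 'rV[R]_n) y :
  br y (\sum_(i <- r) f i) = \sum_(i <- r) br y (f i).
Proof. by rewrite brC br_suml -sumrN; apply: eq_bigr => i _; rewrite -brC. Qed.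

(** The matrix of [ad], each [ad x] being flattened to a row. As the kernel of a linear map the
    center is a vector space with a dimension. *)
Definition br_rows : 'M[R]_(n, n * n) :=
  \matrix_(i < n) mxvec (\matrix_(j < n) br (delta_mx 0 i) (delta_mx 0 j)).

Definition lie_center : {vspace 'rV[R]_n} := lker (linfun (mulmxr br_rows)).

Lemma mul_br_rows z :
  z *m br_rows = mxvec (\matrix_(j < n) br z (delta_mx 0 j)).
Proof.
rewrite {1}[z]row_sum_delta mulmx_suml.
under eq_bigr => i _ do rewrite -scalemxAl -rowE rowK -linearZ.
rewrite -linear_sum; congr mxvec; apply/row_matrixP => j.
rewrite rowK [X in br X _]row_sum_delta br_suml.
rewrite linear_sum; apply: eq_bigr => i _.
by rewrite linearZ /= rowK brZl.
Qed.

Lemma lie_centerP z : reflect (forall x, br z x = 0) (z \in lie_center).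
Proof.
rewrite memv_ker lfunE /= mul_br_rows.
apply: (iffP eqP) => [h x|h]; last first.
  rewrite -[RHS](linear0 mxvec); congr mxvec; apply/row_matrixP => j.
  by rewrite rowK h row0.
have {}h : \matrix_(j < n) br z (delta_mx 0 j) = 0.
  by rewrite -[LHS]mxvecK h linear0.
rewrite [x]row_sum_delta br_sumr big1 // => j _; rewrite brZr.
by move/(congr1 (row j)): h; rewrite rowK row0 => ->; rewrite scaler0.
Qed.

Lemma center_brl x y : br x y \in lie_center.
Proof. by apply/lie_centerP => z; rewrite br_brl. Qed.

Lemma br_centerl z x : z \in lie_center -> br z x = 0.
Proof. by move/lie_centerP. Qed.

Lemma br_centerr z x : z \in lie_center -> br x z = 0.
Proof. by rewrite brC => /br_centerl ->; rewrite oppr0. Qed.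

Lemma in_centerE z : in_center br z <-> z \in lie_center.
Proof.
split=> [h|/lie_centerP h x]; last by rewrite /gmul h (brC z) h oppr0 (addrC x).
apply/lie_centerP => x; move: (h x); rewrite /gmul (addrC x z) => /addrI.
move/(congr1 (GRing.scale 2)); rewrite !scalerA divff ?pnatr_eq0 // !scale1r.
move=> e; have : br z x + br z x = 0 by rewrite {2}e brC addNr.
by move/eqP; rewrite -mulr2n -scaler_nat scaler_eq0 pnatr_eq0 => /eqP.
Qed.

End Bracket.

Section GroupAut.
Variables (R : realType) (n : nat) (br : 'rV[R]_n -> 'rV[R]_n -> 'rV[R]_n).
Hypothesis Hbr : two_step br.
Local Notation Z := (lie_center br).

Lemma half_add (x : 'rV[R]_n) : 2^-1 *: x + 2^-1 *: x = x.
Proof. by rewrite -scalerDl -[RHS]scale1r; congr (_ *: _); field. Qed.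

Lemma group_aut_lie_ring F : bijective F ->
  {morph F : x y / x + y} -> (forall x y, F (br x y) = br (F x) (F y)) ->
  group_aut br F.
Proof.
move=> bF FD Fbr; split=> // x y; rewrite /gmul !FD; congr (_ + _).
(* Without homogeneity of [F] the factor one half is recovered from [F b + F b]. *)
set b := 2^-1 *: br x y.
have : F b + F b = br (F x) (F y) by rewrite -FD half_add Fbr.
by move=> <-; rewrite scalerDr half_add.
Qed.

Section Fixed.
Variable F : 'rV[R]_n -> 'rV[R]_n.
Hypothesis HF : group_aut br F.

Let FM x y : F (gmul br x y) = gmul br (F x) (F y).
Proof. by case: HF => _; apply. Qed.

Lemma gmul_commute x y : br x y = 0 -> gmul br x y = x + y.
Proof. by rewrite /gmul => ->; rewrite scaler0 addr0. Qed.

Lemma group_aut_center z : (F z \in Z) = (z \in Z).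
Proof.
apply/idP/idP => /(in_centerE Hbr) h; apply/(in_centerE Hbr) => x.
  by apply: (bij_inj HF.1); rewrite !FM h.
by have [G _ GK] := HF.1; rewrite -(GK x) -!FM h.
Qed.

(** Sum and product coincide against a central element, so additivity is available there first. It
    yields inverses, then brackets as group commutators, and at last additivity in general by
    cancelling the Baker-Campbell-Hausdorff term. *)
Let FD0 x y : br x y = 0 -> y \in Z -> F (x + y) = F x + F y.
Proof.
move=> h hy; rewrite -gmul_commute // FM gmul_commute //.
by apply: br_centerr => //; rewrite group_aut_center.
Qed.

Lemma group_aut0 : F 0 = 0.
Proof.
have := FD0 (br_alt Hbr 0) (mem0v _).
by rewrite addr0 => /eqP; rewrite -subr_eq0 opprD addNKr oppr_eq0 => /eqP.
Qed.

Lemma group_autN x : F (- x) = - F x.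
Proof.
have h : gmul br x (- x) = 0.
  by rewrite gmul_commute ?subrr // brNr // br_alt // oppr0.
have e : gmul br (F x) (F (- x)) = 0 by rewrite -FM h group_aut0.
have e2 : br (F x) (F (- x)) = 0.
  move/(congr1 (br (F x))): e; rewrite /gmul !brDr // br0r // br_alt // add0r.
  by rewrite brZr // br_brr // scaler0 addr0.
by move/eqP: e; rewrite gmul_commute // addrC addr_eq0 => /eqP.
Qed.

(* The group commutator of [exp x] and [exp y] is [exp (br x y)]. *)
Lemma commutatorE x y :
  gmul br (gmul br x y) (gmul br (- x) (- y)) = br x y.
Proof.
rewrite /gmul !(brDl Hbr, brDr Hbr, brZl Hbr, brZr Hbr, brNl Hbr, brNr Hbr).
rewrite !(br_brl Hbr, br_brr Hbr, br_alt Hbr) (brC Hbr x y).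
by rewrite -[RHS]half_add; apply/rowP => i; rewrite !mxE; field.
Qed.

Lemma group_aut_br x y : F (br x y) = br (F x) (F y).
Proof. by rewrite -commutatorE !FM !group_autN commutatorE. Qed.

Lemma group_autD : {morph F : x y / x + y}.
Proof.
move=> x y.
have hb : 2^-1 *: br x y \in Z by rewrite memvZ // center_brl.
have e : F (gmul br x y) = F (x + y) + F (2^-1 *: br x y).
  by rewrite /gmul FD0 // br_centerr.
have e2 : F (2^-1 *: br x y) = 2^-1 *: br (F x) (F y).
  rewrite -group_aut_br -[in RHS](half_add (br x y)) FD0 ?(br_alt Hbr) //.
  by rewrite [RHS]scalerDr half_add.
by move: e; rewrite FM e2 /gmul => /addIr ->.
Qed.

Lemma group_autB x y : F (x - y) = F x - F y.
Proof. by rewrite group_autD group_autN. Qed.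

Lemma group_aut_sum (I : Type) (r : seq I) (f : I -> 'rV[R]_n) :
  F (\sum_(i <- r) f i) = \sum_(i <- r) F (f i).
Proof. exact: (big_morph F group_autD group_aut0). Qed.

End Fixed.

Lemma group_aut_comp F G : group_aut br F -> group_aut br G ->
  group_aut br (F \o G).
Proof.
move=> [bF FM] [bG GM]; split; first exact: bij_comp.
by move=> x y /=; rewrite GM FM.
Qed.

Lemma group_aut_can F G : group_aut br F -> cancel F G -> cancel G F ->
  group_aut br G.
Proof.
move=> [bF FM] FK GK; split; first by exists F.
by move=> x y; apply: (can_inj FK); rewrite FM !GK.
Qed.

Lemma central_autE mu : central_aut br mu <->
  group_aut br mu /\ forall x, mu x - x \in Z.
Proof.
have key x y : in_center br (gmul br (- x) y) <-> y - x \in Z.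
  rewrite in_centerE // /gmul (addrC (- x)) rpredDr // memvZ //.
  exact: center_brl.
by split=> -[h1 h2]; split=> // x; [apply/key | apply/key]; apply: h2.
Qed.

End GroupAut.

Section LinearMaps.
Variables (R : realType).

Lemma linear_continuous_rV n m (f : {linear 'rV[R]_n -> 'rV[R]_m}) :
  continuous (f : 'rV[R]_n -> 'rV[R]_m).
Proof.
have -> : (f : 'rV[R]_n -> 'rV[R]_m) =
    fun x => \sum_(i < n) x 0 i *: f (delta_mx 0 i).
  apply/funext => x; rewrite {1}[x]row_sum_delta linear_sum.
  by apply: eq_bigr => i _; rewrite linearZ.
apply: continuous_big => [|i _ x]; first exact: add_continuous.
by apply: cvgZr_tmp; [apply: nbhs_filter | apply: (@coord_continuous R 1 n 0 i)].
Qed.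

Lemma linear_fun_mulmx n m (f : 'rV[R]_n -> 'rV[R]_m) :
  (forall a x y, f (a *: x + y) = a *: f x + f y) ->
  exists M : 'M[R]_(n, m), f = mulmxr M.
Proof.
move=> flin; exists (\matrix_i f (delta_mx 0 i)); apply/funext => x /=.
have f0 : f 0 = 0.
  by have := flin (-1) 0 0; rewrite scaler0 addr0 scaleN1r addNr.
have fD y z : f (y + z) = f y + f z by have := flin 1 y z; rewrite !scale1r.
have fZ a y : f (a *: y) = a *: f y by have := flin a y 0; rewrite !addr0 f0 addr0.
rewrite {1}[x]row_sum_delta (big_morph f fD f0) [RHS]mulmx_sum_row.
by apply: eq_bigr => i _; rewrite fZ rowK.
Qed.

Lemma linear_fun_continuous n m (f : 'rV[R]_n -> 'rV[R]_m) :
  (forall a x y, f (a *: x + y) = a *: f x + f y) -> continuous f.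
Proof.
by move=> /linear_fun_mulmx[M ->]; apply: linear_continuous_rV.
Qed.

Lemma linear_inj_bij n (f : 'rV[R]_n -> 'rV[R]_n) :
  (forall a x y, f (a *: x + y) = a *: f x + f y) -> injective f ->
  bijective f.
Proof.
move=> /linear_fun_mulmx[M ->] Minj.
have Mu : M \in unitmx.
  rewrite -row_free_unit; apply: inj_row_free => v vM.
  by apply: Minj; rewrite /= vM mul0mx.
by exists (mulmxr (invmx M)) => x /=; rewrite ?mulmxK ?mulmxKV.
Qed.

End LinearMaps.

(** * Linearization of automorphisms that are linear modulo the center *)

Section Linearize.
Variables (R : realType) (n : nat) (br : 'rV[R]_n -> 'rV[R]_n -> 'rV[R]_n).
Hypothesis Hbr : two_step br.
Local Notation Z := (lie_center br).
Variable G : 'rV[R]_n -> 'rV[R]_n.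
Hypothesis HG : group_aut br G.
Hypothesis GZ : forall a (x : 'rV[R]_n), G (a *: x) - a *: G x \in Z.

Let Dgen : seq 'rV[R]_n :=
  [seq br (delta_mx 0 i) (delta_mx 0 j) | i <- enum 'I_n, j <- enum 'I_n].
Let D : {vspace 'rV[R]_n} := <<Dgen>>%VS.

Let memD x y : br x y \in D.
Proof.
rewrite [x]row_sum_delta br_suml // memv_suml // => i _.
rewrite [y]row_sum_delta br_sumr // memv_suml // => j _.
rewrite brZl // brZr // !memvZ // memv_span //.
by apply/allpairsP; exists (i, j); rewrite /= !mem_enum.
Qed.

(** The scalar can be moved into one argument, where the central defect of homogeneity of [G] is
    lost in the bracket. Hence [G] is truly linear on the derived algebra, not only modulo the
    center. *)
Let GZbr t p q : G (t *: br p q) = t *: br (G p) (G q).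
Proof.
rewrite -(brZl Hbr) (group_aut_br Hbr HG) -[G (t *: p)](subrK (t *: G p)).
by rewrite brDl // brZl // (br_centerl Hbr) ?add0r //; apply: GZ.
Qed.

Let GD v : v \in D -> G v \in D /\ forall a, G (a *: v) = a *: G v.
Proof.
move=> vD; rewrite (coord_span (X := in_tuple Dgen) vD).
set X := in_tuple _; set c := coord X.
have Xbr i : exists p q, X`_i = br p q.
  have [hi|hi] := ltnP i (size X); last first.
    by exists 0, 0; rewrite nth_default // br0l.
  by have /allpairsP[pq [_ _ ->]] := mem_nth 0 hi; eexists; eexists.
split=> [|a].
  rewrite (group_aut_sum Hbr HG) memv_suml // => i _.
  by have [p [q ->]] := Xbr i; rewrite GZbr memvZ.
rewrite scaler_sumr !(group_aut_sum Hbr HG) scaler_sumr.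
apply: eq_bigr => i _; have [p [q ->]] := Xbr i.
by rewrite scalerA !GZbr scalerA.
Qed.

Let subDZ v : v \in D -> v \in Z.
Proof.
have : (D <= Z)%VS; last by move/subvP; apply.
by apply/span_subvP => _ /allpairsP[ij [_ _ ->]]; apply: center_brl.
Qed.

(* [Fb] is [G] modulo the center and on the derived algebra [D], and the
   identity on a complement of [D] in the center. *)
Let Fb x := (G x - projv Z (G x)) +
  (G (projv D (projv Z x)) + projv Z x - projv D (projv Z x)).

Let Fb_linear a x y : Fb (a *: x + y) = a *: Fb x + Fb y.
Proof.
have GDZ : G (projv D (projv Z (a *: x + y))) =
    a *: G (projv D (projv Z x)) + G (projv D (projv Z y)).
  rewrite !linearP (group_autD Hbr HG) (GD _).2 //; exact: memv_proj.
have GP : G (a *: x + y) - projv Z (G (a *: x + y)) =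
    a *: (G x - projv Z (G x)) + (G y - projv Z (G y)).
  have [z zZ e] : exists2 z, z \in Z & G (a *: x) = z + a *: G x.
    by exists (G (a *: x) - a *: G x); rewrite ?subrK.
  rewrite (group_autD Hbr HG) e !linearD /= (projv_id zZ) linearZ /=.
  by apply/rowP => i; rewrite !mxE; ring.
rewrite /Fb GDZ GP !linearP /=.
by apply/rowP => i; rewrite !mxE; ring.
Qed.

Let Fb_sub x : Fb x - G x \in Z.
Proof.
have -> : Fb x - G x = - projv Z (G x) +
    (G (projv D (projv Z x)) + projv Z x - projv D (projv Z x)).
  by apply/rowP => i; rewrite /Fb !mxE; ring.
by rewrite rpredD ?rpredN ?memv_proj // rpredB ?rpredD ?memv_proj //;
  apply: subDZ; [apply: (GD _).1|]; apply: memv_proj.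
Qed.

Let Fb_inj : injective Fb.
Proof.
suff Fb0 x : Fb x = 0 -> x = 0.
  move=> x y e; apply/eqP; rewrite -subr_eq0; apply/eqP/Fb0.
  by rewrite addrC -scaleN1r Fb_linear e scaleN1r addNr.
move=> e; have xZ : x \in Z.
  rewrite -(group_aut_center Hbr HG) -[G x]opprK rpredN.
  by have := Fb_sub x; rewrite e sub0r.
have GxZ : G x \in Z by rewrite (group_aut_center Hbr HG).
move: e; rewrite /Fb (projv_id GxZ) subrr add0r (projv_id xZ) => e.
have p0 : projv D x = 0.
  apply: (bij_inj HG.1); rewrite (group_aut0 Hbr HG).
  rewrite -(projv_id (GD (memv_proj D x)).1).
  move/(congr1 (projv D)): e.
  by rewrite linearB linearD /= (projv_id (memv_proj D x)) addrK linear0.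
by move: e; rewrite p0 (group_aut0 Hbr HG) add0r subr0.
Qed.

(** [Fb] preserves brackets because it agrees with [G] modulo the center and on the derived algebra.
    The remaining factor, [G] after the inverse of [Fb], is then the identity modulo the center. *)
Lemma linearize : exists mu Fb', [/\ central_aut br mu, lie_group_aut br Fb' &
  forall x, G x = mu (Fb' x)].
Proof.
have Fbij : bijective Fb by apply: linear_inj_bij.
have Fbbr x y : Fb (br x y) = br (Fb x) (Fb y).
  have -> : br (Fb x) (Fb y) = br (G x) (G y).
    have dec u : exists2 z, z \in Z & Fb u = z + G u.
      by exists (Fb u - G u); rewrite ?subrK.
    have [[z zZ ->] [w wZ ->]] := (dec x, dec y).
    rewrite !(brDl Hbr, brDr Hbr) !(br_centerl Hbr _ zZ).
    by rewrite (br_centerr Hbr _ wZ) !add0r.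
  have bZ := center_brl Hbr x y.
  rewrite /Fb (projv_id bZ) (projv_id (memD x y)) addrK.
  have GbZ : G (br x y) \in Z by rewrite (group_aut_center Hbr HG).
  by rewrite (projv_id GbZ) subrr add0r (group_aut_br Hbr HG).
have Fbg : group_aut br Fb.
  apply: group_aut_lie_ring => // x y.
  by have := Fb_linear 1 x y; rewrite !scale1r.
have [H FK HK] := Fbij.
exists (G \o H), Fb; split; last by move=> x /=; rewrite FK.
  apply/central_autE => //; split.
    by apply: group_aut_comp => //; apply: group_aut_can FK HK.
  move=> x /=; rewrite -{2}(HK x) -rpredN opprB; exact: Fb_sub.
split=> //; exact: linear_fun_continuous.
Qed.

End Linearize.

Lemma field_aut_id (R : realType) n (br : 'rV[R]_n -> 'rV[R]_n -> 'rV[R]_n) :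
  field_aut br id.
Proof.
exists 1%N, (fun=> 1%:M), (fun=> id); split.
- by rewrite mxdirectE /= !big_ord1.
- by rewrite big_ord1.
- by move=> i x v _; apply: submx1.
- by move=> i; left.
- by move=> u _.
Qed.

(** * Double centralizers *)

Definition mk_rmorphism (S T : nzRingType) (f : S -> T) (fB : zmod_morphism f)
  (fM : monoid_morphism f) : {rmorphism S -> T} :=
  HB.pack f (GRing.isZmodMorphism.Build S T f fB)
            (GRing.isMonoidMorphism.Build S T f fM).

(** Nonnegative reals are squares, so [f] is monotone; it fixes the rationals, which are dense. *)
Lemma real_rmorphism_id (R : realType) (f : {rmorphism R -> R}) : f =1 id.
Proof.
have f_ge0 x : 0 <= x -> 0 <= f x.
  by move=> x0; rewrite -(sqr_sqrtr x0) rmorphXn sqr_ge0.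
have f_mono x y : x <= y -> f x <= f y.
  by rewrite -subr_ge0 => /f_ge0; rewrite rmorphB subr_ge0.
move=> x; apply/eqP; rewrite eq_le; apply/andP; split; rewrite leNgt;
  apply/negP => /rat_in_itvoo[q]; rewrite in_itv /= => /andP[h1 h2].
  by have := f_mono _ _ (ltW h1); rewrite fmorph_rat leNgt h2.
by have := f_mono _ _ (ltW h2); rewrite fmorph_rat leNgt h1.
Qed.

Section Criterion.
Variables (R : realType) (n : nat) (br : 'rV[R]_n -> 'rV[R]_n -> 'rV[R]_n).
Hypothesis Hbr : two_step br.
Local Notation Z := (lie_center br).

(* The double centralizer of [x] is as small as possible. *)
Definition good (x : 'rV[R]_n) :=
  forall y, (forall w, br x w = 0 -> br y w = 0) ->
  exists a, forall w, br (y - a *: x) w = 0.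

Definition good_pair x y := [/\ good x, good y & br x y <> 0].

Section FixF.
Variables F G : 'rV[R]_n -> 'rV[R]_n.
Hypothesis HF : group_aut br F.
Hypotheses (FK : cancel F G) (GK : cancel G F).

Let HG : group_aut br G. Proof. exact: group_aut_can HF FK GK. Qed.
(** Multiplication by [a] transported through [F]. By [T_brl] and [T_brr] it lies in the centroid of
    the Lie ring, so whatever commutes with [x] commutes with [T a x], and the double centralizer of
    [x] is preserved. *)
Let T a x := G (a *: F x).

Let TD a x y : T a (x + y) = T a x + T a y.
Proof. by rewrite /T (group_autD Hbr HF) scalerDr (group_autD Hbr HG). Qed.

Let T_center a z : z \in Z -> T a z \in Z.
Proof.
by move=> hz; rewrite (group_aut_center Hbr HG) memvZ ?(group_aut_center Hbr HF).
Qed.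

Let T_brl a x y : br (T a x) y = T a (br x y).
Proof.
rewrite /T (group_aut_br Hbr HF) -(brZl Hbr) (group_aut_br Hbr HG).
by rewrite FK.
Qed.

Let T_brr a x y : br x (T a y) = T a (br x y).
Proof.
rewrite /T (group_aut_br Hbr HF) -(brZr Hbr) (group_aut_br Hbr HG).
by rewrite FK.
Qed.

Let T_good x : good x -> exists phi : R -> R, forall a, T a x - phi a *: x \in Z.
Proof.
move=> gx; have : forall a, exists c, T a x - c *: x \in Z; last first.
  by move=> /boolp.choice[phi h]; exists phi.
move=> a; have [|c hc] := gx (T a x); last by exists c; apply/(lie_centerP Hbr).
by move=> w h; rewrite T_brl h /T (group_aut0 Hbr HF) scaler0 (group_aut0 Hbr HG).
Qed.

Let good_scale x t : good x -> t != 0 -> good (t *: x).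
Proof.
move=> gx t0 y hy; have [|a ha] := gx y.
  by move=> w hw; apply: hy; rewrite brZl // hw scaler0.
by exists (a / t) => w; rewrite scalerA divfK.
Qed.

(** Moving [T a] across the bracket of [t *: x] and [y] shows that its scalar at [t *: x] is its
    scalar [phi a] at [y], for every [t]. This independence of [t] is what makes [phi]
    multiplicative. *)
Let pair_scalar x y : good_pair x y ->
  forall a t, T a (t *: x) - (a * t) *: x \in Z.
Proof.
move=> [gx gy nxy]; have [phi phiP] := T_good gy.
have phix a t : T a (t *: x) - (phi a * t) *: x \in Z.
  have [->|t0] := eqVneq t 0.
    rewrite /T mulr0 !scale0r (group_aut0 Hbr HF) scaler0 (group_aut0 Hbr HG).
    by rewrite subr0 mem0v.
  have [psi psiP] := T_good (good_scale gx t0).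
  have e u v (c : R) : u - c *: v \in Z -> exists2 z, z \in Z & u = z + c *: v.
    by move=> h; exists (u - c *: v); rewrite ?subrK.
  have [[z zZ ez] [w wZ ew]] := (e _ _ _ (psiP a), e _ _ _ (phiP a)).
  suff h : psi a = phi a by rewrite -h -scalerA ez addrK.
  have : br (T a (t *: x)) y = br (t *: x) (T a y) by rewrite T_brl T_brr.
  rewrite ez ew brDl // brDr // (br_centerl Hbr) // (br_centerr Hbr _ wZ) !add0r.
  rewrite !(brZl Hbr, brZr Hbr) !scalerA => /eqP.
  rewrite -subr_eq0 -scalerBl scaler_eq0 => /orP[|/eqP//].
  by rewrite (mulrC t) -mulrBl mulf_eq0 (negPf t0) orbF subr_eq0 => /eqP.
have xZ : x \notin Z by apply/negP => /(lie_centerP Hbr)/(_ y).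
have inj c d : (c - d) *: x \in Z -> c = d.
  move=> h; apply/eqP; rewrite -subr_eq0; apply: contraNT xZ => cd.
  by rewrite -(scale1r x) -(mulVf cd) -scalerA memvZ.
have phi1 a : T a x - phi a *: x \in Z.
  by have := phix a 1; rewrite scale1r mulr1.
have phiB : zmod_morphism phi.
  move=> a b; apply: inj.
  have TB : T (a - b) x = T a x - T b x.
    by rewrite /T scalerBl (group_autB Hbr HG).
  have -> : (phi (a - b) - (phi a - phi b)) *: x =
    (T a x - phi a *: x) - (T b x - phi b *: x) - (T (a - b) x - phi (a - b) *: x).
    rewrite TB.
    by apply/rowP => i; rewrite !mxE; ring.
  by apply: rpredB; [apply: rpredB|]; apply: phi1.
have phiM : monoid_morphism phi.
  split=> [|a b]; apply: inj.
    have := phi1 1; rewrite /T scale1r FK => h.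
    by rewrite -opprB scaleNr rpredN scalerBl scale1r.
  have TM : T (a * b) x = T a (T b x) by rewrite /T GK scalerA.
  have -> : (phi (a * b) - phi a * phi b) *: x =
    T a (T b x - phi b *: x) + (T a (phi b *: x) - (phi a * phi b) *: x)
    - (T (a * b) x - phi (a * b) *: x).
    have e : T a (T b x) = T a (T b x - phi b *: x) + T a (phi b *: x).
      by rewrite -TD subrK.
    rewrite TM e.
    by apply/rowP => i; rewrite !mxE; ring.
  by apply: rpredB; [apply: rpredD => //; apply: T_center|]; apply: phi1.
have phi_id := real_rmorphism_id (mk_rmorphism phiB phiM).
by move=> a t; have := phix a t; rewrite [phi a]phi_id.
Qed.

Lemma good_span_semilinear a v :
  (exists r : seq (R * 'rV[R]_n),
    (forall p, p \in r -> exists y, good_pair p.2 y) /\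
    v - \sum_(p <- r) p.1 *: p.2 \in Z) ->
  F (a *: v) - a *: F v \in Z.
Proof.
move=> [r [hr hv]].
suff h : T a v - a *: v \in Z.
  have -> : F (a *: v) - a *: F v = - F (T a v - a *: v).
    by rewrite (group_autB Hbr HF) /T GK opprB.
  by rewrite rpredN (group_aut_center Hbr HF).
set s := \sum_(p <- r) _ in hv.
have -> : T a v - a *: v = T a (v - s) + (T a s - a *: s) - a *: (v - s).
  rewrite -{1}[v](subrK s) TD.
  by apply/rowP => i; rewrite !mxE; ring.
rewrite rpredB ?memvZ // rpredD // ?T_center // /s {hv s}.
elim: r hr => [|p r IH] hr.
  rewrite big_nil /T (group_aut0 Hbr HF) scaler0 (group_aut0 Hbr HG).
  by rewrite subr0 mem0v.
rewrite big_cons TD scalerDr opprD addrACA rpredD //.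
  have [|y /pair_scalar] := hr p; first exact: mem_head.
  by move/(_ a p.1); rewrite scalerA.
by apply: IH => q hq; apply: hr; rewrite inE hq orbT.
Qed.
End FixF.

Definition good_spanned := forall v, exists r : seq (R * 'rV[R]_n),
    (forall p, p \in r -> exists y, good_pair p.2 y) /\
    forall w, br (v - \sum_(p <- r) p.1 *: p.2) w = 0.

Lemma good_spanned_pac : good_spanned -> partial_auto_cont br.
Proof.
move=> hs F HF; have [G FK GK] := HF.1.
have FZ a (v : 'rV[R]_n) : F (a *: v) - a *: F v \in Z.
  apply: (good_span_semilinear HF FK GK); have [r [h1 h2]] := hs v.
  by exists r; split=> //; apply/(lie_centerP Hbr).
have [mu [Fb [h1 h2 h3]]] := linearize Hbr HF FZ.
exists mu, Fb, id; split=> //; exact: field_aut_id.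
Qed.

End Criterion.

(** * The complex Heisenberg algebra *)

Section ComplexHeisenberg.
Variable R : realType.
Local Notation C := R[i].
Local Notation E := 'rV[C]_3.
Let o0 : 'I_3 := @Ordinal 3 0 isT.
Let o1 : 'I_3 := @Ordinal 3 1 isT.
Let o2 : 'I_3 := @Ordinal 3 2 isT.

Definition heis_const (l j : 'I_3) : 'rV[C]_3 :=
  (((l == 0%N :> nat) && (j == 1%N :> nat))%:R
   - ((l == 1%N :> nat) && (j == 0%N :> nat))%:R) *: delta_mx 0 o2.

Let cbr := cbracket heis_const.

Lemma cbrE z w : cbr z w = (z 0 o0 * w 0 o1 - z 0 o1 * w 0 o0) *: delta_mx 0 o2.
Proof.
rewrite /cbr /cbracket /heis_const !big_ord_recl !big_ord0 /=.
have -> : lift ord0 (ord0 : 'I_2) = o1 by apply/val_inj.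
have -> : lift ord0 (lift ord0 (ord0 : 'I_1)) = o2 by apply/val_inj.
have -> : ord0 = o0 by apply/val_inj.
by apply/rowP => i; rewrite !mxE; ring.
Qed.

Lemma rV3P (z : E) : z = z 0 o0 *: delta_mx 0 o0 + z 0 o1 *: delta_mx 0 o1
  + z 0 o2 *: delta_mx 0 o2.
Proof.
apply/rowP => -[[|[|[|k]]] hk] //; rewrite !mxE !eqxx /=;
  rewrite ?mulr1 ?mulr0 ?addr0 ?add0r; congr (z 0 _); exact/val_inj.
Qed.

Variables (n : nat) (br : 'rV[R]_n -> 'rV[R]_n -> 'rV[R]_n).
Hypothesis Hbr : two_step br.
Local Notation Z := (lie_center br).
Variables (psi : E -> 'rV[R]_n) (iv : 'rV[R]_n -> E).
Hypothesis psiL : forall (a : R) z w, psi ((a%:C)%C *: z + w) = a *: psi z + psi w.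
Hypotheses (psiK : cancel psi iv) (ivK : cancel iv psi).
Hypothesis psibr : forall z w, psi (cbr z w) = br (psi z) (psi w).

Let psi0 : psi 0 = 0.
Proof. by have := psiL (-1) 0 0; rewrite scaler0 addr0 scaleN1r addNr. Qed.
Let psiD z w : psi (z + w) = psi z + psi w.
Proof. by have := psiL 1 z w; rewrite rmorph1 !scale1r. Qed.
Let psiZ a z : psi ((a%:C)%C *: z) = a *: psi z.
Proof. by have := psiL a z 0; rewrite !addr0 psi0 addr0. Qed.
Let psiN z : psi (- z) = - psi z.
Proof. by apply/eqP; rewrite -addr_eq0 -psiD addNr psi0. Qed.
Let ivD x y : iv (x + y) = iv x + iv y.
Proof. by apply: (can_inj psiK); rewrite psiD !ivK. Qed.
Let iv0 : iv 0 = 0. Proof. by rewrite -psi0 psiK. Qed.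

Let psi_center z : (psi z \in Z) <-> (z 0 o0 = 0 /\ z 0 o1 = 0).
Proof.
split=> [/(lie_centerP Hbr) h|[h0 h1]].
  have hc w : cbr z w = 0 by apply: (can_inj psiK); rewrite psibr h psi0.
  have := congr1 (fun v : E => v 0 o2) (hc (delta_mx 0 o0)).
  have := congr1 (fun v : E => v 0 o2) (hc (delta_mx 0 o1)).
  rewrite !cbrE !mxE !eqxx /= => e1 e2.
  split; [move: e1 | move: e2]; rewrite !(mulr0, mulr1, subr0, sub0r) //.
  by move/eqP; rewrite oppr_eq0 => /eqP.
apply/(lie_centerP Hbr) => x; rewrite -(ivK x) -psibr cbrE h0 h1 !mul0r subrr scale0r.
exact: psi0.
Qed.

Variable F : 'rV[R]_n -> 'rV[R]_n.
Hypothesis HF : group_aut br F.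
Let f z := iv (F (psi z)).

Let fD z w : f (z + w) = f z + f w.
Proof. by rewrite /f psiD (group_autD Hbr HF) ivD. Qed.
Let fbr z w : f (cbr z w) = cbr (f z) (f w).
Proof.
by rewrite /f psibr (group_aut_br Hbr HF); apply: (can_inj psiK);
   rewrite psibr !ivK.
Qed.
Let f0 : f 0 = 0. Proof. by rewrite /f psi0 (group_aut0 Hbr HF). Qed.
Let f_bij : bijective f.
Proof.
have [G FK GK] := HF.1; exists (fun z => iv (G (psi z))) => z.
  by rewrite /f ivK FK psiK.
by rewrite /f ivK GK psiK.
Qed.
Let e0 : E := delta_mx 0 o0.
Let e1 : E := delta_mx 0 o1.
Let e2 : E := delta_mx 0 o2.
Let p := f e0.
Let q := f e1.
(** The determinant of the images of [e0] and [e1] modulo the center; also the factor by which [f]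
    moves [e2]. *)
Let beta := p 0 o0 * q 0 o1 - p 0 o1 * q 0 o0.

Let beta_neq0 : beta != 0.
Proof.
apply/eqP => b0; have : f (cbr e0 e1) = f 0.
  by rewrite f0 fbr cbrE -/p -/q -/beta b0 scale0r.
move/(bij_inj f_bij); rewrite cbrE => /(congr1 (fun v : E => v 0 o2)).
rewrite !mxE !eqxx /= !mulr1 mulr0 subr0 => /eqP.
by rewrite oner_eq0.
Qed.

(* [F (c e_i)] commutes with [F e_i], hence is a complex multiple of it modulo
   the center. *)
Let proportional (u v : E) : ~ (u 0 o0 = 0 /\ u 0 o1 = 0) -> cbr v u = 0 ->
  exists c, v 0 o0 = c * u 0 o0 /\ v 0 o1 = c * u 0 o1.
Proof.
move=> un; rewrite cbrE => /(congr1 (fun v : E => v 0 o2)).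
rewrite !mxE !eqxx /= mulr1 => /eqP; rewrite subr_eq0 => /eqP e.
have [u0|u0] := eqVneq (u 0 o0) 0; last first.
  exists (v 0 o0 / u 0 o0); rewrite divfK //; split=> //.
  by rewrite mulrAC e mulfK.
have u1 : u 0 o1 != 0 by apply/eqP => u1; apply: un.
exists (v 0 o1 / u 0 o1); rewrite divfK //; split=> //.
by rewrite mulrAC -e mulfK.
Qed.

Let phi_ex0 c : exists a, (f (c *: e0)) 0 o0 = a * p 0 o0 /\ (f (c *: e0)) 0 o1 = a * p 0 o1.
Proof.
apply: proportional.
  by move=> [h0 h1]; move: beta_neq0; rewrite /beta h0 h1 !mul0r subrr eqxx.
by rewrite -fbr cbrE !mxE !eqxx /= !(mulr0, mul0r) subrr scale0r f0.
Qed.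
Let phi_ex1 c : exists a, (f (c *: e1)) 0 o0 = a * q 0 o0 /\ (f (c *: e1)) 0 o1 = a * q 0 o1.
Proof.
apply: proportional.
  by move=> [h0 h1]; move: beta_neq0; rewrite /beta h0 h1 !mulr0 subrr eqxx.
by rewrite -fbr cbrE !mxE !eqxx /= !(mulr0, mul0r) subrr scale0r f0.
Qed.

(** The bracket of [c *: e0] and [d *: e1] depends only on the product of [c] and [d]. Comparing
    factorizations identifies the two scalar functions and makes them multiplicative; additivity is
    that of [f] on the line of [e2]. Surjectivity holds because the inverse of [f] also preserves
    the center. *)
Lemma heisenberg_semilinear : exists phi : {rmorphism C -> C}, bijective phi /\
  forall z : E, (f z) 0 o0 = phi (z 0 o0) * p 0 o0 + phi (z 0 o1) * q 0 o0 /\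
            (f z) 0 o1 = phi (z 0 o0) * p 0 o1 + phi (z 0 o1) * q 0 o1.
Proof.
have [phi phiP] := boolp.choice phi_ex0; have [psi1 psi1P] := boolp.choice phi_ex1.
have fe2 c d : f ((c * d) *: e2) = (phi c * psi1 d * beta) *: e2.
  have -> : (c * d) *: e2 = cbr (c *: e0) (d *: e1).
    by rewrite cbrE !mxE !eqxx /= !mulr1 !mulr0 subr0.
  rewrite fbr cbrE; have [-> ->] := phiP c; have [-> ->] := psi1P d.
  by congr (_ *: _); rewrite /beta; ring.
have inj c d : c *: e2 = d *: e2 -> c = d.
  by move=> /(congr1 (fun v : E => v 0 o2)); rewrite !mxE !eqxx /= !mulr1.
have one : phi 1 = 1 /\ psi1 1 = 1.
  have [h0 h1] := phiP 1; have [h2 h3] := psi1P 1.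
  rewrite !scale1r -/p -/q in h0 h1 h2 h3.
  split; apply: (mulIf beta_neq0); rewrite mul1r /beta.
    by rewrite {2}h0 {2}h1; ring.
  by rewrite {2}h2 {2}h3; ring.
have [phi1 psi11] := one.
have psiE c : psi1 c = phi c.
  have := fe2 1 c; have := fe2 c 1; rewrite mulr1 mul1r phi1 psi11 mulr1 mul1r => ->.
  by move=> /inj /(mulIf beta_neq0) ->.
have fZe2 c : f (c *: e2) = (phi c * beta) *: e2.
  by have := fe2 c 1; rewrite mulr1 psi11 mulr1.
have phiB : zmod_morphism phi.
  move=> c d; apply: (mulIf beta_neq0); apply: inj.
  rewrite mulrBl scalerBl -!fZe2 scalerBl; apply/eqP; rewrite eq_sym subr_eq.
  by rewrite -fD subrK.
have phiM : monoid_morphism phi.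
  split=> // c d; apply: (mulIf beta_neq0); apply: inj.
  by rewrite -fZe2 fe2 psiE.
exists (mk_rmorphism phiB phiM); split.
  have phi_inj : injective phi := fmorph_inj (mk_rmorphism phiB phiM).
  have phi_surj d : exists c, phi c = d.
    have [g fK gK] := f_bij; pose y := g ((d * beta) *: e2).
    have [y0 y1] : y 0 o0 = 0 /\ y 0 o1 = 0.
      apply/psi_center; rewrite -(group_aut_center Hbr HF) -[F _]ivK.
      rewrite -/(f y) /y gK; apply/psi_center; rewrite !mxE /=.
      by rewrite !mulr0.
    exists (y 0 o2); apply: (mulIf beta_neq0); apply: inj; rewrite -fZe2.
    by rewrite -[RHS]gK -/y [y in RHS]rV3P y0 y1 !scale0r !add0r.
  have [phi' phi'P] := boolp.choice phi_surj.
  exists phi'; first by move=> c; apply: phi_inj; apply: phi'P.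
  exact: phi'P.
move=> z.
have fz : f z = f (z 0 o0 *: e0) + f (z 0 o1 *: e1) + f (z 0 o2 *: e2).
  by rewrite {1}(rV3P z) !fD.
have [h0 h1] := phiP (z 0 o0); have [h2 h3] := psi1P (z 0 o1).
rewrite fz fZe2 !mxE /= h0 h1 h2 h3 !mulr0 !addr0 !psiE.
by [].
Qed.

Lemma heisenberg_decomp : exists mu Fb Phi,
  [/\ central_aut br mu, lie_group_aut br Fb, field_aut br Phi &
      forall x, F x = mu (Fb (Phi x))].
Proof.
have [phi [[phi' phiK phi'K] phiP]] := heisenberg_semilinear.
pose Phi x := psi (map_mx phi (iv x)); pose Phi' x := psi (map_mx phi' (iv x)).
have PhiK : cancel Phi Phi'.
  move=> x; rewrite /Phi /Phi' psiK -map_mx_comp -[RHS]ivK; congr psi.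
  by apply/rowP => i; rewrite mxE /= phiK.
have Phi'K : cancel Phi' Phi.
  move=> x; rewrite /Phi /Phi' psiK -map_mx_comp -[RHS]ivK; congr psi.
  by apply/rowP => i; rewrite mxE /= phi'K.
have cphi l j k : phi (heis_const l j 0 k) = heis_const l j 0 k.
  rewrite /heis_const !mxE rmorphM rmorphB !rmorph_nat.
  by case: (_ == k) => //=; rewrite ?rmorph0 ?rmorph1.
have mapbr z w : map_mx phi (cbr z w) = cbr (map_mx phi z) (map_mx phi w).
  by rewrite !cbrE map_mxZ map_delta_mx rmorphB !rmorphM /= !mxE.
have ivbr x y : iv (br x y) = cbr (iv x) (iv y).
  by apply: (can_inj psiK); rewrite psibr !ivK.
have PhiG : group_aut br Phi.
  apply: group_aut_lie_ring; first by exists Phi'.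
    by move=> x y; rewrite /Phi ivD map_mxD psiD.
  by move=> x y; rewrite /Phi ivbr mapbr psibr.
(* Undoing the field automorphism leaves a map that is linear modulo the center, to which
   [linearize] applies. *)
pose G := F \o Phi'.
have HG : group_aut br G.
  by apply: group_aut_comp HF _; apply: group_aut_can PhiG PhiK Phi'K.
have GZ a (x : 'rV[R]_n) : G (a *: x) - a *: G x \in Z.
  have ivZ : iv (a *: x) = (a%:C)%C *: iv x.
    by apply: (can_inj psiK); rewrite psiZ !ivK.
  have GE y : G y = psi (f (map_mx phi' (iv y))) by rewrite /f ivK.
  rewrite !GE -psiZ -psiN -psiD; apply/psi_center.
  rewrite ivZ; set z := map_mx phi' _; set w := map_mx phi' _.
  have [h0 h1] := phiP z; have [h2 h3] := phiP w.
  rewrite !mxE h0 h1 h2 h3 !mxE !phi'K.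
  by split; ring.
have [mu [Fb [hmu hFb GE]]] := linearize Hbr HG GZ.
exists mu, Fb, Phi; split=> //; last by move=> x; rewrite -GE /G /= PhiK.
exists 1%N, (fun=> 1%:M), (fun=> Phi); split.
- by rewrite mxdirectE /= !big_ord1.
- by rewrite big_ord1.
- by move=> i x v _; apply: submx1.
- move=> i; right; exists 3, heis_const, psi, phi; split=> //.
  + exact: can_inj psiK.
  + by move=> z; apply: submx1.
  + by move=> v _; exists (iv v).
  + by split=> //; [exists phi' | move=> z; rewrite /Phi psiK].
- by move=> u _; rewrite !big_ord1.
Qed.

End ComplexHeisenberg.

(** * Derivations of the real numbers *)

Section Derivations.
Local Open Scope classical_set_scope.
Variable F : numFieldType.

(* The graph of a derivation from a subring of [F] to [F], that is, a subring
   of the dual numbers that meets the multiples of epsilon only at 0. *)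
Definition derivation_graph (A : set (F * F)) :=
  [/\ A (1, 0),
      forall p q, A p -> A q -> A (p.1 - q.1, p.2 - q.2),
      forall p q, A p -> A q -> A (p.1 * q.1, p.1 * q.2 + p.2 * q.1) &
      forall v, A (0, v) -> v = 0].

Section Extension.
Variable A : set (F * F).
Hypothesis HA : derivation_graph A.

Let A1 : A (1, 0). Proof. by case: HA. Qed.
Let A_B a u b v : A (a, u) -> A (b, v) -> A (a - b, u - v).
Proof. by case: HA => _ h _ _ /h; apply. Qed.
Let A_M a u b v : A (a, u) -> A (b, v) -> A (a * b, a * v + u * b).
Proof. by case: HA => _ _ h _ /h; apply. Qed.
Let A0 : A (0, 0). Proof. by have := A_B A1 A1; rewrite !subrr. Qed.
Let A_N a u : A (a, u) -> A (- a, - u).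
Proof. by move/(A_B A0); rewrite !sub0r. Qed.
Let A_D a u b v : A (a, u) -> A (b, v) -> A (a + b, u + v).
Proof. by move=> ha /A_N /(A_B ha); rewrite !opprK. Qed.
Let A_fun v : A (0, v) -> v = 0. Proof. by case: HA => _ _ _; apply. Qed.
Let A_n a u m : A (a, u) -> A (a *+ m, u *+ m).
Proof.
by move=> h; elim: m => [|m IH]; rewrite ?mulr0n ?mulrS //; apply: A_D.
Qed.
Let A_sum (I : Type) (r : seq I) (f g : I -> F) :
  (forall i, A (f i, g i)) -> A (\sum_(i <- r) f i, \sum_(i <- r) g i).
Proof.
move=> h; elim: r => [|i r IH]; first by rewrite !big_nil.
by rewrite !big_cons; apply: A_D.
Qed.

(** [q] is the polynomial obtained by applying the derivation to each coefficient of [p]. *)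
Definition coef_in (p q : {poly F}) := forall i, A (p`_i, q`_i).

Let cB p q p' q' : coef_in p q -> coef_in p' q' -> coef_in (p - p') (q - q').
Proof. by move=> h h' i; rewrite !coefB; apply: A_B. Qed.

Let cM p q p' q' : coef_in p q -> coef_in p' q' ->
  coef_in (p * p') (p * q' + q * p').
Proof.
move=> h h' i; rewrite coefD !coefM -big_split /=.
by apply: A_sum => j; apply: A_M.
Qed.

Let cC a u : A (a, u) -> coef_in a%:P u%:P.
Proof. by move=> h i; rewrite !coefC; case: ifP. Qed.

Let cXn k : coef_in 'X^k 0.
Proof. by move=> i; rewrite coefXn coef0; case: eqP. Qed.

Let c_deriv p q : coef_in p q -> coef_in (deriv p) (deriv q).
Proof. by move=> h i; rewrite !coef_deriv; apply: A_n. Qed.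

Let c0 q : coef_in 0 q -> q = 0.
Proof.
by move=> h; apply/polyP => i; rewrite coef0; apply: A_fun; have := h i; rewrite coef0.
Qed.

(** An extension with value [u] at [x] must send [p.[x]] to [q.[x] + u * (deriv p).[x]]; this is the
    condition for that formula to be well defined. *)
Definition compatible x u :=
  forall p q, coef_in p q -> p.[x] = 0 -> q.[x] + u * (deriv p).[x] = 0.

Definition extend x u : set (F * F) :=
  [set w | exists p q, [/\ coef_in p q, w.1 = p.[x] & w.2 = q.[x] + u * (deriv p).[x]]].

Lemma extend_graph x u : compatible x u -> derivation_graph (extend x u).
Proof.
move=> cxu; split.
- exists 1, 0; split; [exact: (cC A1) | by rewrite -polyC1 hornerC |].
  by rewrite -polyC1 derivC !horner0 mulr0 addr0.
- move=> _ _ [p [q [h -> ->]]] [p' [q' [h' -> ->]]].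
  exists (p - p'), (q - q'); split=> /=; first exact: cB.
    by rewrite !hornerE.
  by rewrite derivB !hornerE; ring.
- move=> _ _ [p [q [h -> ->]]] [p' [q' [h' -> ->]]].
  exists (p * p'), (p * q' + q * p'); split=> /=; first exact: cM.
    by rewrite !hornerE.
  by rewrite derivM !hornerE; ring.
- by move=> v [p [q [h /= e ->]]]; apply: cxu.
Qed.

Lemma extend_sub x u : A `<=` extend x u.
Proof.
move=> [a v] h; exists a%:P, v%:P; split=> /=; first exact: cC.
  by rewrite hornerC.
by rewrite derivC horner0 mulr0 addr0 hornerC.
Qed.

Lemma extend_mem x u : extend x u (x, u).
Proof.
exists 'X, 0; split; first by rewrite -['X]expr1; apply: cXn.
  by rewrite hornerX.
by rewrite derivX horner0 add0r /= -polyC1 hornerC mulr1.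
Qed.

(* The value [u] at [x] is forced by an equation of [x] of least degree. *)
Lemma compatible_exists x : exists u, compatible x u.
Proof.
pose P m := `[< exists p q, [/\ coef_in p q, p != 0, p.[x] = 0 & size p = m] >].
have [[m Pm]|noP] := pselect (exists m, P m); last first.
  exists 0 => p q h px; have [p0|p0] := eqVneq p 0.
    by rewrite p0 in h *; rewrite (c0 h) horner0 mul0r addr0.
  by exfalso; apply: noP; exists (size p); apply/asboolP; exists p, q.
have := ex_minnP (ex_intro _ m Pm) => -[k /asboolP[p0 [q0 [h0 p0N p0x sk]]] kmin].
(* In characteristic zero the derivative of the nonconstant [p0] is a nonzero polynomial of smaller
   size with admissible coefficients, so a root at [x] would contradict minimality. *)
have p0'x : (deriv p0).[x] != 0.
  apply/eqP => e.
  have sp0 : (1 < size p0)%N.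
    rewrite ltnNge; apply/negP => /size1_polyC e1.
    move: p0x p0N; rewrite e1 hornerC => ->; by rewrite eqxx.
  have p0'N : (deriv p0) != 0.
    apply/eqP => /(congr1 (fun r : {poly F} => r`_(size p0).-2)).
    rewrite coef0 coef_deriv => /eqP; rewrite mulrn_eq0 /=.
    have -> : (size p0).-2.+1 = (size p0).-1 by lia.
    by rewrite -[_`__]/(lead_coef p0) lead_coef_eq0 (negPf p0N).
  have : P (size (deriv p0)).
    by apply/asboolP; exists (deriv p0), (deriv q0); split=> //; apply: c_deriv.
  by move/kmin; rewrite -sk leqNgt lt_size_deriv.
exists (- q0.[x] / (deriv p0).[x]); set u := _ / _.
have u0 : q0.[x] + u * (deriv p0).[x] = 0 by rewrite /u divfK // addrN.
move=> p q; have [s] := ubnP (size p); elim: s p q => // s IH p q sp h px.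
have [pz|pz] := eqVneq p 0.
  by rewrite pz in h *; rewrite (c0 h) horner0 deriv0 horner0 mulr0 addr0.
have kp : (k <= size p)%N by apply: kmin; apply/asboolP; exists p, q.
(* One step of pseudo-division: the coefficients come from a subring, so [p] is multiplied by [l0]
   instead of being divided. [l0'] and [l'] are the derivatives of the leading coefficients, which
   makes [q1] the partner of [p1]. *)
pose l0 := lead_coef p0; pose l0' := q0`_(size p0).-1.
pose l := lead_coef p; pose l' := q`_(size p).-1.
pose d := (size p - size p0)%N.
pose r := l%:P * 'X^d; pose r' := l'%:P * 'X^d.
pose p1 := l0%:P * p - r * p0.
pose q1 := (l0%:P * q + l0'%:P * p) - (r * q0 + r' * p0).
have h1 : coef_in p1 q1.
  apply: cB; first by apply: cM => //; apply: cC; apply: h0.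
  apply: cM => //; have := cM (cC (h (size p).-1)) (cXn d).
  by rewrite mulr0 add0r.
have p1x : p1.[x] = 0 by rewrite /p1 !hornerE px p0x !mulr0 subrr.
have l0N : l0 != 0 by rewrite lead_coef_eq0.
have sp1 : (size p1 < s)%N.
  have pgt : (0 < size p)%N by rewrite size_poly_gt0.
  have p0gt : (0 < size p0)%N by rewrite size_poly_gt0.
  have pp0 : (size p0 <= size p)%N by rewrite sk.
  have e1 a b : (0 < b -> b <= a -> a.-1 - (a - b) = b.-1)%N by lia.
  have e2 a b j : (0 < a -> a.-1 < j -> b <= a -> b <= j - (a - b))%N by lia.
  have e3 a j : (0 < a -> a.-1 < j -> a <= j)%N by lia.
  suff : (size p1 <= (size p).-1)%N by move: sp pgt; lia.
  apply/leq_sizeP => j hj; rewrite /p1 /r coefB -!mulrA !coefCM coefXnM.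
  rewrite ltnNge; have -> /= : (d <= j)%N by rewrite /d; lia.
  move: hj; rewrite leq_eqVlt => /orP[/eqP <-|hj].
    rewrite /d e1 // -[p`__]/l; by rewrite -[p0`__]/l0 mulrC subrr.
  have -> : p`_j = 0 by apply: nth_default; apply: e3.
  have -> : p0`_(j - d) = 0 by apply: nth_default; apply: e2.
  by rewrite !mulr0 subrr.
have := IH _ _ sp1 h1 p1x.
have -> : q1.[x] + u * (deriv p1).[x] =
    l0 * (q.[x] + u * (deriv p).[x]) - l * x ^+ d * (q0.[x] + u * (deriv p0).[x])
    + (l0' * p.[x] - l' * x ^+ d * p0.[x]) - u * (deriv r).[x] * p0.[x].
  have rx : r.[x] = l * x ^+ d by rewrite /r !hornerE.
  have r'x : r'.[x] = l' * x ^+ d by rewrite /r' !hornerE.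
  rewrite /q1 /p1; clearbody r r'.
  rewrite derivB (derivM r) deriv_mulC !(hornerD, hornerN, hornerM, hornerC) rx r'x.
  by ring.
rewrite u0 px p0x !mulr0 !subr0 addr0 => /eqP; rewrite mulf_eq0 (negPf l0N).
by move/eqP.
Qed.

End Extension.

Lemma derivation_extends A0 : derivation_graph A0 ->
  exists D : F -> F, [/\ {morph D : x y / x + y},
    (forall x y, D (x * y) = x * D y + D x * y) &
    forall x u, A0 (x, u) -> D x = u].
Proof.
move=> HA0.
pose P := [set A | A = set0 \/ (derivation_graph A /\ A0 `<=` A)].
have [|A [PA Amax]] := @Zorn_bigcup _ P.
  move=> C CP Ctot.
  have [[X [CX Xn]]|none] := pselect (exists X, C X /\ X <> set0); last first.
    left; apply/seteqP; split=> // w [X CX Xw]; apply: none; exists X.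
    by split=> // X0; rewrite X0 in Xw.
  have der Y w : C Y -> Y w -> derivation_graph Y /\ A0 `<=` Y.
    by move=> CY Yw; case: (CP _ CY) => // Y0; rewrite Y0 in Yw.
  have both p q : (\bigcup_(X in C) X) p -> (\bigcup_(X in C) X) q ->
      exists Y, [/\ C Y, Y p & Y q].
    move=> [Y CY Yp] [Y' CY' Yq]; case: (Ctot _ _ CY CY') => s.
      by exists Y'; split=> //; apply: s.
    by exists Y; split=> //; apply: s.
  right; have [[X1 _ _ _] AX] : derivation_graph X /\ A0 `<=` X by case: (CP _ CX).
  split; last by move=> w /AX Xw; exists X.
  split; first by exists X.
  - move=> p q /both h /h[Y [CY Yp Yq]]; exists Y => //.
    by have [[_ hB _ _] _] := der _ _ CY Yp; apply: hB.
  - move=> p q /both h /h[Y [CY Yp Yq]]; exists Y => //.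
    by have [[_ _ hM _] _] := der _ _ CY Yp; apply: hM.
  - move=> v [Y CY Yv].
    by have [[_ _ _ h] _] := der _ _ CY Yv; apply: h.
have {PA}[HA AA0] : derivation_graph A /\ A0 `<=` A.
  case: PA => // eA; exfalso; apply: (Amax A0); last by right; split.
  rewrite eA; split=> // h; case: HA0 => /h.
  by [].
(* A maximal graph is total, as it could otherwise be extended by one more point. *)
have tot x : exists u, A (x, u).
  have [u cu] := compatible_exists HA x.
  exists u; apply: contrapT => nA; apply: (Amax (extend A x u)).
    split; first exact: extend_sub.
    by move/(_ _ (extend_mem HA x u)).
  right; split; first exact: extend_graph.
  by apply: subset_trans AA0 _; apply: extend_sub.
have [D DP] := boolp.choice tot.
have Dfun x u : A (x, u) -> D x = u.
  move=> h; case: (HA) => _ hB _ hf.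
  have := hB _ _ (DP x) h; rewrite /= subrr => /hf /eqP.
  by rewrite subr_eq0 => /eqP.
have [h1 hB hM _] := HA.
exists D; split.
- move=> x y; apply: Dfun.
  have h0 := hB _ _ h1 h1; have := hB _ _ (DP x) (hB _ _ h0 (DP y)).
  by rewrite /= !subrr !sub0r !opprK.
- by move=> x y; apply: Dfun; have := hM _ _ (DP x) (DP y).
- by move=> x u /AA0 /Dfun.
Qed.

End Derivations.

(** * A transcendental number and a nonzero derivation *)

Section Transcendental.
Local Open Scope classical_set_scope.
Variable R : realType.

Lemma finite_roots (p : {poly R}) : p != 0 -> finite_set [set x | root p x].
Proof.
move=> p0; apply: contrapT => /(@infinite_set_fset _ _ (size p))[B Bp sB].
have rB : all (root p) (finmap.enum_fset B) by apply/allP => x xB; apply: Bp.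
have := max_poly_roots p0 rB (finmap.fset_uniq B).
by rewrite ltnNge sB.
Qed.

(** The algebraic numbers are a countable union of finite root sets, whereas the unit interval has
    Lebesgue measure one. *)
Lemma transcendental_exists :
  exists t : R, forall p : {poly int}, p != 0 -> ~~ root (map_poly intr p) t.
Proof.
apply: contrapT => none.
pose alg := \bigcup_(p in [set p : {poly int} | p != 0])
   [set x : R | root (map_poly intr p) x].
have calg : countable alg.
  apply: bigcup_countable => [|p /= p0]; first exact: countableP.
  apply: finite_set_countable; apply: finite_roots.
  by rewrite map_poly_eq0_id0 // ?intr_eq0 ?lead_coef_eq0.
have algT : alg = setT.
  apply/seteqP; split=> // x _; apply: contrapT => nx; apply: none; exists x => p p0.
  by apply/negP => rp; apply: nx; exists p.
pose I := (Interval (BLeft (0 : R)) (BRight 1)).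
have cI : countable [set` I].
  by apply: sub_countable calg; rewrite algT; apply: subset_card_le.
have := lebesgue_measure_itv I; rewrite countable_lebesgue_measure0 //.
rewrite /I /= lte_fin ltr01 oppr0 adde0 => /esym/eqP.
by rewrite onee_eq0.
Qed.

Lemma derivation_exists : exists D : R -> R, [/\ {morph D : x y / x + y},
  (forall x y, D (x * y) = x * D y + D x * y) & exists t, D t = 1].
Proof.
have [t tT] := transcendental_exists.
pose A0 : set (R * R) := [set w | exists m : int, w.1 = m%:~R /\ w.2 = 0].
have HA0 : derivation_graph A0.
  split.
  - by exists 1.
  - move=> _ _ [m [-> ->]] [m' [-> ->]]; exists (m - m').
    by rewrite /= rmorphB subrr.
  - move=> _ _ [m [-> ->]] [m' [-> ->]]; exists (m * m').
    by rewrite /= rmorphM mulr0 mul0r addr0.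
  - by move=> v [m [_ /= ->]].
(* No nonzero integer polynomial vanishes at [t], so the zero derivation of the integers puts no
   constraint on the value at [t]. *)
have ct : compatible A0 t 1.
  move=> p q h pt.
  have [m mP] := boolp.choice (fun i => h i).
  suff p0 : p = 0.
    have -> : q = 0 by apply/polyP => i; rewrite coef0; have [] := mP i.
    by rewrite p0 deriv0 horner0 mulr0 addr0.
  pose r := \poly_(i < size p) m i.
  have pr : p = map_poly intr r.
    apply/polyP => i; rewrite coef_map coef_poly /=.
    have [hi|hi] := ltnP i (size p); first by have [] := mP i.
    by rewrite nth_default.
  apply/eqP; apply: contraT => pN.
  have rN : r != 0 by apply: contraNneq pN => r0; rewrite pr r0 rmorph0.
  by have := tT _ rN; rewrite -pr /root pt eqxx.
have [D [DD DM DA]] := derivation_extends (extend_graph HA0 ct).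
exists D; split=> //; exists t; apply: DA; exact: extend_mem.
Qed.

End Transcendental.

(** * Brackets given by structure constants *)

Section Structure.
Variable R : realType.

Definition co n (x : 'rV[R]_n.+1) (i : nat) : R := x 0 (inord i).
Definition ev n (i : nat) : 'rV[R]_n.+1 := delta_mx 0 (inord i).

(* A triple [(i, j, k)] in [l] stands for the relation [e_i, e_j] = e_k. *)
Definition sbr n (l : seq (nat * nat * nat)) (x y : 'rV[R]_n.+1) : 'rV[R]_n.+1 :=
  \sum_(t <- l) (co x t.1.1 * co y t.1.2 - co x t.1.2 * co y t.1.1) *: ev n t.2.

Lemma coD n (x y : 'rV[R]_n.+1) i : co (x + y) i = co x i + co y i.
Proof. by rewrite /co mxE. Qed.
Lemma coN n (x : 'rV[R]_n.+1) i : co (- x) i = - co x i.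
Proof. by rewrite /co mxE. Qed.
Lemma coZ n a (x : 'rV[R]_n.+1) i : co (a *: x) i = a * co x i.
Proof. by rewrite /co mxE. Qed.
Lemma co0 n i : co (0 : 'rV[R]_n.+1) i = 0.
Proof. by rewrite /co mxE. Qed.
Lemma co_sum n (I : Type) (r : seq I) (f : I -> 'rV[R]_n.+1) i :
  co (\sum_(j <- r) f j) i = \sum_(j <- r) co (f j) i.
Proof. by rewrite /co summxE. Qed.
Lemma co_ev n i j : (i <= n)%N -> (j <= n)%N -> co (ev n i) j = (i == j)%:R.
Proof.
move=> hi hj; rewrite /co mxE eqxx /= eq_sym; congr (nat_of_bool _)%:R.
by apply/eqP/eqP => [/(congr1 val)|->//]; rewrite /= !inordK.
Qed.
Lemma coP n (x y : 'rV[R]_n.+1) :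
  (forall i, (i <= n)%N -> co x i = co y i) -> x = y.
Proof.
by move=> h; apply/rowP => i; have := h i (ltn_ord i); rewrite /co inord_val.
Qed.
Lemma co_sum_ev n (x : 'rV[R]_n.+1) : x = \sum_(i < n.+1) co x i *: ev n i.
Proof.
rewrite {1}[x]row_sum_delta; apply: eq_bigr => i _.
by rewrite /co /ev inord_val.
Qed.

(** Brackets read only coordinates below [k] and write only coordinates from [k] on, so the latter
    are central and all double brackets vanish. *)
Definition graded n (l : seq (nat * nat * nat)) k :=
  all (fun t => [&& t.1.1 < k, t.1.2 < k, k <= t.2 & t.2 <= n])%N l.

Lemma co_sbr_low n l k x y i : graded n l k -> (i < k)%N -> (i <= n)%N ->
  co (sbr (n := n) l x y) i = 0.
Proof.
move=> /allP lk ik i_n; rewrite co_sum big_seq big1 // => t /lk/and4P[_ _ kt tn].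
rewrite coZ co_ev //; have [e|] := eqVneq; last by rewrite mulr0.
by move: kt; rewrite e leqNgt ik.
Qed.

Lemma sbr_low n l k (x y : 'rV[R]_n.+1) : graded n l k ->
  (forall i, (i < k)%N -> co x i = 0) -> sbr l x y = 0.
Proof.
move=> /allP lk x0; rewrite /sbr big_seq big1 // => t /lk/and4P[h1 h2 _ _].
by rewrite !x0 // !mul0r subrr scale0r.
Qed.

Lemma sbr_two_step n l k : graded n l k -> (k <= n.+1)%N ->
  (exists x y, sbr (n := n) l x y <> 0) -> two_step (sbr (n := n) l).
Proof.
move=> lk kn nz.
have z2 (x y z : 'rV[R]_n.+1) : sbr l (sbr l x y) z = 0.
  apply: (sbr_low _ lk) => i ik; apply: (co_sbr_low _ _ lk) => //.
  by rewrite -ltnS; apply: leq_trans kn.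
have sC (x y : 'rV[R]_n.+1) : sbr l y x = - sbr l x y.
  rewrite /sbr -sumrN; apply: eq_bigr => t _.
  by apply/rowP => i; rewrite !mxE; ring.
split=> //; split.
- move=> a x y z; rewrite /sbr scaler_sumr -big_split /=.
  by apply: eq_bigr => t _; rewrite !coD !coZ; apply/rowP => i; rewrite !mxE; ring.
- move=> a x y z; rewrite /sbr scaler_sumr -big_split /=.
  by apply: eq_bigr => t _; rewrite !coD !coZ; apply/rowP => i; rewrite !mxE; ring.
- move=> x; rewrite /sbr big1 // => t _.
  by rewrite [X in _ - X]mulrC subrr scale0r.
- by move=> x y z; rewrite ![sbr _ _ (sbr _ _ _)]sC !z2 oppr0 !addr0.
Qed.

Definition n6_rel := [:: (0, 1, 4); (0, 2, 5); (1, 3, 5)]%N.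

Lemma n6_brE : @n6_br R = sbr (n := 5) n6_rel.
Proof.
apply/funext => x; apply/funext => y; rewrite /sbr !big_cons big_nil addr0 /=.
by apply/rowP => i; rewrite /n6_br /co !mxE; ring.
Qed.

End Structure.

Ltac vec := apply/rowP => ?; rewrite !mxE; ring.

Ltac sbr_at k H := move: (congr1 (fun v => co v k) H);
  rewrite /sbr !big_cons !big_nil /= !(coD, coZ, co0, coN) !co_ev //=; try lia.

Ltac sbr_zero := rewrite /sbr !big_cons !big_nil /= ?(coD, coZ, coN) ?co_ev //=; try lia;
  apply/rowP => ?; rewrite !mxE; ring.

(** * The algebra N_6 *)

(** The set where [g] differs from its linear candidate is open and contains no rational. *)
Lemma additive_continuous_linear (R : realType) (g : R -> R) :
  {morph g : x y / x + y} -> continuous g -> forall a, g a = a * g 1.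
Proof.
move=> gD gc a; apply/eqP; apply: contraT => ne.
pose h x := g x - x * g 1.
have hc : continuous h.
  move=> x; apply: cvgB; first exact: gc.
  apply: cvgM; [exact: cvg_id | exact: cvg_cst].
have g0 : g 0 = 0 by apply: (addrI (g 0)); rewrite -gD !addr0.
have gN x : g (- x) = - g x by apply/eqP; rewrite -addr_eq0 -gD addNr g0.
have gn x m : g (x *+ m) = g x *+ m.
  by elim: m => [|m IH]; rewrite ?mulr0n // !mulrS gD IH.
have gz x (m : int) : g (x *~ m) = g x *~ m.
  by case: m => m; rewrite ?NegzE ?mulrNz ?gN -?pmulrn gn.
have gq (q : rat) : g (ratr q) = ratr q * g 1.
  have dN : (denq q)%:~R != 0 :> R by rewrite intr_eq0 denq_neq0.
  have e : (denq q)%:~R * ratr q = (numq q)%:~R :> R by rewrite /ratr mulrC divfK.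
  by apply: (mulfI dN); rewrite mulrA e !mulrzl -!gz -[ratr q *~ _]mulrzl e.
have [||y [/= hy [q _ qy]]] := @dense_rat R (h @^-1` [set x | x != 0])%classic.
- by exists a; rewrite /= /h subr_eq0.
- by apply: open_comp; [move=> x _; exact: hc | exact: open_neq].
- by move: hy; rewrite /h -qy gq subrr eqxx.
Qed.

Section N6.
Variable R : realType.
Local Notation V := 'rV[R]_6.
Local Notation br := (@sbr R 5 n6_rel).
Local Notation e := (@ev R 5).

Lemma n6_graded : graded 5 n6_rel 4. Proof. by []. Qed.

Lemma n6E (x y : V) : br x y =
  (co x 0 * co y 1 - co x 1 * co y 0) *: e 4 +
  (co x 0 * co y 2 - co x 2 * co y 0 + co x 1 * co y 3 - co x 3 * co y 1) *: e 5.
Proof.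
rewrite /sbr !big_cons big_nil /=.
by apply/rowP => i; rewrite !mxE; ring.
Qed.

Lemma co4_n6 (x y : V) : co (br x y) 4 = co x 0 * co y 1 - co x 1 * co y 0.
Proof. by rewrite n6E coD !coZ !co_ev //=; ring. Qed.

Lemma co5_n6 (x y : V) : co (br x y) 5 =
  co x 0 * co y 2 - co x 2 * co y 0 + co x 1 * co y 3 - co x 3 * co y 1.
Proof. by rewrite n6E coD !coZ !co_ev //=; ring. Qed.

Lemma n6_two_step : two_step br.
Proof.
apply: (sbr_two_step n6_graded) => //; exists (e 0), (e 1).
move/(congr1 (fun x => co x 4)); rewrite co4_n6 !co_ev // co0 /= mulr1 mulr0 subr0.
by move/eqP; rewrite oner_eq0.
Qed.
Let Hbr := n6_two_step.

Lemma n6_central_co (x : V) : (forall y, br x y = 0) ->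
  [/\ co x 0 = 0, co x 1 = 0, co x 2 = 0 & co x 3 = 0].
Proof.
move=> h; have h4 y := congr1 (fun x => co x 4) (h y).
have h5 y := congr1 (fun x => co x 5) (h y).
have := (h4 (e 0), h4 (e 1), h5 (e 0), h5 (e 1)).
rewrite !co4_n6 !co5_n6 !co0 !co_ev //=.
by move=> [[[h1 h2] h3] h6]; split; lra.
Qed.

Section Wild.
Variable D : R -> R.
Hypothesis DD : {morph D : x y / x + y}.
Hypothesis DM : forall x y, D (x * y) = x * D y + D x * y.

Let D0 : D 0 = 0. Proof. by apply: (addrI (D 0)); rewrite -DD !addr0. Qed.
Let DN x : D (- x) = - D x.
Proof. by apply/eqP; rewrite -addr_eq0 -DD addNr D0. Qed.

(* The automorphism induced by the ring automorphism
   [a + b eps |-> a + (b + D a) eps] of the dual numbers; here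
   [eps X1 = - X4], [eps X2 = X3] and [eps Z1 = Z2]. *)
Definition wild (s : R) (x : V) : V :=
  x + (s * D (co x 1)) *: e 2 - (s * D (co x 0)) *: e 3 + (s * D (co x 4)) *: e 5.

Lemma co_wild s x :
  [/\ co (wild s x) 0 = co x 0, co (wild s x) 1 = co x 1,
      co (wild s x) 2 = co x 2 + s * D (co x 1),
      co (wild s x) 3 = co x 3 - s * D (co x 0) &
      co (wild s x) 4 = co x 4].
Proof. by split; rewrite !coD coN !coZ !co_ev //=; ring. Qed.

Lemma wildK s : cancel (wild s) (wild (- s)).
Proof.
move=> x; have [h0 h1 _ _ h4] := co_wild s x.
rewrite {1}/wild h0 h1 h4 /wild.
by apply/rowP => i; rewrite !mxE; ring.
Qed.

Lemma wild_group_aut : group_aut br (wild 1).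
Proof.
apply: group_aut_lie_ring.
- exists (wild (-1)); first exact: wildK.
  by move=> x; rewrite -{1}[1]opprK wildK.
- move=> x y; rewrite /wild !coD !DD; apply/rowP => i; rewrite !mxE; ring.
- move=> x y; have [hx0 hx1 hx2 hx3 _] := co_wild 1 x.
  have [hy0 hy1 hy2 hy3 _] := co_wild 1 y.
  rewrite [RHS]n6E hx0 hx1 hx2 hx3 hy0 hy1 hy2 hy3 /wild co4_n6.
  rewrite !(co_sbr_low _ _ n6_graded) // D0 DD DN !DM n6E.
  by apply/rowP => i; rewrite !mxE; ring.
Qed.
End Wild.

(** A linear map commuting with brackets sends X1 to a X1 + b eps X1 modulo the center. The
    X1-coordinate of [J (J (e 0))] is then the square of a, which cannot be -1. *)
Lemma n6_no_complex_structure (J : V -> V) :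
  (forall a x y, J (a *: x + y) = a *: J x + J y) ->
  (forall x y, br (J x) y = J (br x y)) -> ~ (forall x, J (J x) = - x).
Proof.
move=> Jlin Jbr JJ.
have J0 : J 0 = 0 by have := Jlin (-1) 0 0; rewrite scaler0 addr0 scaleN1r addNr.
have : br (J (e 0)) (e 0) = 0 by rewrite Jbr br_alt.
move=> h; have := congr1 (fun x => co x 4) h; have := congr1 (fun x => co x 5) h.
rewrite /= co4_n6 co5_n6 !co0 !co_ev //= => h5 h4 {h}.
have [p1 p2] : co (J (e 0)) 1 = 0 /\ co (J (e 0)) 2 = 0 by split; lra.
set p := J (e 0) in p1 p2 h4 h5 *.
pose z := p - co p 0 *: e 0 - co p 3 *: e 3.
have zc : co (J z) 0 = 0.
  suff : forall y, br (J z) y = 0 by move/n6_central_co => [].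
  move=> y; rewrite Jbr (_ : br z y = 0) // (sbr_low _ n6_graded) // => i.
  rewrite !coD !coN !coZ; case: i => [|[|[|[|]]]] // _; rewrite !co_ev //= ?p1 ?p2; ring.
have e3 : co (J (e 3)) 0 = 0.
  have : br (J (e 3)) (e 2) = 0.
    rewrite Jbr n6E !co_ev //= -[RHS]J0; congr J.
    by apply/rowP => i; rewrite !mxE; ring.
  move/(congr1 (fun x => co x 5)); rewrite co5_n6 co0 !co_ev //=.
  by move=> h; lra.
have : co (J p) 0 = -1 by rewrite JJ coN co_ev.
have -> : p = co p 0 *: e 0 + (co p 3 *: e 3 + z).
  by apply/rowP => i; rewrite !mxE; ring.
rewrite !Jlin !coD !coZ e3 zc mulr0 !addr0 -/p => h.
by have := sqr_ge0 (co p 0); rewrite expr2 h; lra.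
Qed.

Lemma complex_twist_structure (W : 'M[R]_6) sig :
  (forall v : V, (v <= W)%MS) -> complex_twist br W sig ->
  exists J : V -> V, [/\ (forall a x y, J (a *: x + y) = a *: J x + J y),
  (forall x y, br (J x) y = J (br x y)) & (forall x, J (J x) = - x)].
Proof.
move=> WT [m [c [psi [phi [psiL psiI _ psiS [psibr _ _ _]]]]]].
have [iv ivP] := boolp.choice (fun v => psiS v (WT v)).
have iK z : iv (psi z) = z by apply: psiI; rewrite ivP.
have ivL a x y : iv (a *: x + y) = (a%:C)%C *: iv x + iv y.
  by apply: psiI; rewrite psiL !ivP.
exists (fun v => psi ('i%C *: iv v)); split=> [a x y|x y|x].
- by rewrite ivL -psiL scalerDr !scalerA mulrC.
- rewrite -{1}(ivP y) -psibr; congr psi.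
  have -> : br x y = psi (cbracket c (iv x) (iv y)) by rewrite psibr !ivP.
  rewrite iK /cbracket scaler_sumr; apply: eq_bigr => l _.
  rewrite scaler_sumr; apply: eq_bigr => j _.
  by rewrite mxE scalerA mulrA.
- rewrite iK scalerA -expr2 sqr_i scaleN1r.
  have := psiL (-1) (iv x) 0; rewrite !addr0 rmorphN rmorph1 !scaleN1r => ->.
  have psi0 : psi 0 = 0.
    by have := psiL (-1) 0 0; rewrite scaler0 addr0 scaleN1r addNr.
  by rewrite psi0 addr0 ivP.
Qed.

Lemma complex_twist0 n (b : 'rV[R]_n -> 'rV[R]_n -> 'rV[R]_n) W sig :
  complex_twist b W sig -> sig 0 = 0.
Proof.
move=> [m [c [psi [phi [psiL _ _ _ [_ _ _ sigP]]]]]].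
have psi0 : psi 0 = 0.
  by have := psiL (-1) 0 0; rewrite scaler0 addr0 scaleN1r addNr.
by have := sigP 0; rewrite psi0 map_mx0 psi0.
Qed.

(** Some summand contains an element [w] with a nonzero X1-coordinate. The brackets of [w] fill the
    center, so this ideal contains it. Any other ideal of the sum meets it in 0; its brackets
    therefore vanish, which makes it central and hence zero. *)
Lemma n6_field_aut Phi : field_aut br Phi -> Phi =1 id.
Proof.
move=> [k [W [sig [dirW WT ideal sigP PhiP]]]].
have /sub_sumsmxP[u ue] : (e 0 <= \sum_(i < k) W i)%MS by rewrite WT submx1.
have [i wi] : exists i, co (u i *m W i) 0 != 0.
  apply: contrapT => none.
  have := congr1 (fun x => co x 0) ue; rewrite /= co_ev // co_sum big1.
    by move/eqP; rewrite oner_eq0.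
  by move=> i _; apply/eqP; apply: contrapT => h; apply: none; exists i; apply/negP.
set w := u i *m W i in wi.
have idealr x v j : (v <= W j)%MS -> (br v x <= W j)%MS.
  by move=> /(ideal j x); rewrite (brC Hbr) eqmx_opp.
(* The witness solves a triangular system: bracketing [w] with s X2 + t X3 gives w0 s Z1 + (w0 t -
   w3 s) Z2. *)
have ZW a b : ((a *: e 4 + b *: e 5)%R <= W i)%MS.
  have <- : br w ((a / co w 0) *: e 1 + ((b + co w 3 * (a / co w 0)) / co w 0) *: e 2)
      = a *: e 4 + b *: e 5.
    rewrite n6E !coD !coZ !co_ev //= !(mulr0, mulr1, addr0, add0r, subr0).
    congr (_ *: _ + _ *: _); by field.
  by apply: idealr; apply: submxMl.
have cW v : (forall y, br v y = 0) -> (v <= W i)%MS.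
  move=> /n6_central_co[v0 v1 v2 v3].
  have -> : v = co v 4 *: e 4 + co v 5 *: e 5; last exact: ZW.
  apply: coP => j hj; rewrite coD !coZ !co_ev //.
  by case: j hj => [|[|[|[|[|[|]]]]]] //= _; rewrite ?v0 ?v1 ?v2 ?v3; ring.
have Wj j (v : V) : j != i -> (v <= W j)%MS -> v = 0.
  move=> ji vj.
  have cap0 (x : V) : (x <= W j)%MS -> (x <= W i)%MS -> x = 0.
    move=> xj xi; apply/eqP; rewrite -submx0.
    have /mxdirect_sumsP/(_ j isT) <- := dirW.
    by rewrite sub_capmx xj (sumsmx_sup i) // eq_sym.
  apply: (cap0 v) => //; apply: cW => y; apply: cap0; first exact: idealr.
  by rewrite n6E; apply: ZW.
have Wfull (v : V) : (v <= W i)%MS.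
  have /sub_sumsmxP[t ->] : (v <= \sum_(i < k) W i)%MS by rewrite WT submx1.
  rewrite (bigD1 i) //= big1 ?addr0 ?submxMl // => j ji.
  by apply: Wj ji _; apply: submxMl.
have PhiE x : Phi x = sig i x.
  have := PhiP (fun j => if j == i then x else 0).
  rewrite (bigD1 i) //= eqxx big1 => [|j /negPf -> //].
  rewrite addr0 => ->; last by move=> j; case: eqP => [->//|_]; apply: sub0mx.
  rewrite (bigD1 i) //= eqxx big1 ?addr0 // => j /negPf ->.
  by case: (sigP j) => [->//|/complex_twist0]; rewrite ?sub0mx.
case: (sigP i) => [h x|]; first by rewrite PhiE h.
by move=> /(complex_twist_structure Wfull)[J [? ? /n6_no_complex_structure[]]].
Qed.

(** A central automorphism leaves the first four coordinates alone and [Phi] is the identity, so the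
    X4-coordinate of [Fb (a *: e 0)] must be [- D a]. Continuity would make [D] linear, against
    [D 1 = 0] and [D t = 1]. *)
Lemma n6_not_pac : ~ partial_auto_cont (@n6_br R).
Proof.
rewrite n6_brE => pac.
have [D [DD DM [t Dt]]] := derivation_exists R.
have [mu [Fb [Phi [/(central_autE Hbr)[_ muZ] [Fbg Fbc] /n6_field_aut Phi1 FE]]]]
  := pac _ (wild_group_aut DD DM).
pose g a := co (Fb (a *: e 0)) 3.
have gE a : g a = - D a.
  have := muZ (Fb (a *: e 0)); rewrite -{1}[a *: e 0]Phi1 -FE.
  move/(lie_centerP Hbr)/n6_central_co=> [_ _ _]; rewrite coD coN => /eqP.
  rewrite subr_eq0 /g => /eqP <-; have [_ _ _ -> _] := co_wild D 1 (a *: e 0).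
  by rewrite !coZ !co_ev //= mulr0 mulr1 add0r mul1r.
have gD : {morph g : x y / x + y}.
  by move=> x y; rewrite /g scalerDl (group_autD Hbr Fbg) coD.
have gc : continuous g.
  move=> a; apply: (@continuous_comp _ _ _ (fun a : R => Fb (a *: e 0)) (fun v : V => co v 3)).
    apply: (@continuous_comp _ _ _ (fun a : R => a *: e 0) Fb); last exact: Fbc.
    by apply: cvgZr_tmp; exact: cvg_id.
  exact: coord_continuous.
have := additive_continuous_linear gD gc t; rewrite !gE Dt.
have D1 : D 1 = 0.
  have := DM 1 1; rewrite !mulr1 mul1r => /eqP.
  by rewrite -subr_eq0 opprD addNKr oppr_eq0 => /eqP.
by rewrite D1 oppr0 mulr0 => /eqP; rewrite oppr_eq0 oner_eq0.
Qed.

End N6.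

(** * Classification *)

Lemma lie_iso_sym (R : realType) n m (b : 'rV[R]_n -> 'rV[R]_n -> 'rV[R]_n)
  (b' : 'rV[R]_m -> 'rV[R]_m -> 'rV[R]_m) : lie_iso b b' -> lie_iso b' b.
Proof.
move=> [f [fl [g fK gK] fb]]; exists g; split.
- by move=> a x y; apply: (can_inj fK); rewrite fl !gK.
- by exists f.
- by move=> x y; apply: (can_inj fK); rewrite fb !gK.
Qed.

(** * Families independent modulo the center *)

Section Independence.
Variables (R : realType) (n : nat).
Local Notation V := 'rV[R]_n.+1.
Variable br : V -> V -> V.
Hypothesis Hbr : two_step br.
Local Notation Z := (lie_center br).

Lemma dim_full_rV : \dim {:V} = n.+1.
Proof. by rewrite dimvf dim_matrix; apply: mul1n. Qed.

Definition indep (X : seq V) := forall k : nat -> R,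
  \sum_(0 <= i < size X) k i *: X`_i \in Z -> forall i, (i < size X)%N -> k i = 0.

Lemma free_comb (X : seq V) : (forall k : nat -> R,
  \sum_(0 <= i < size X) k i *: X`_i = 0 -> forall i, (i < size X)%N -> k i = 0) ->
  free X.
Proof.
move=> h; rewrite -[X]/(tval (in_tuple X)); apply/freeP => k e i.
have := h (fun j => if insub j is Some o then k o else 0).
rewrite big_mkord => /(_ _ i (ltn_ord i)); rewrite valK; apply.
by rewrite -[RHS]e; apply: eq_bigr => j _; rewrite valK.
Qed.

Lemma comb_free (X : seq V) : free X -> forall k : nat -> R,
  \sum_(0 <= i < size X) k i *: X`_i = 0 -> forall i, (i < size X)%N -> k i = 0.
Proof.
rewrite -[X]/(tval (in_tuple X)) => /freeP h k; rewrite big_mkord => e i hi.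
exact: (h (fun j : 'I_(size X) => k j) e (Ordinal hi)).
Qed.

Lemma span_comb (X : seq V) v : v \in <<X>>%VS ->
  exists k : nat -> R, v = \sum_(0 <= i < size X) k i *: X`_i.
Proof.
rewrite -[X]/(tval (in_tuple X)) => /coord_span ->.
set c := coord _; exists (fun j => if insub j is Some o then c o v else 0).
by rewrite big_mkord; apply: eq_bigr => j _; rewrite valK.
Qed.

Lemma indep_free X : indep X -> free X.
Proof. by move=> h; apply: free_comb => k e; apply: h; rewrite e mem0v. Qed.

Lemma indep_cap X : indep X -> (<<X>> :&: Z = 0)%VS.
Proof.
move=> h; apply/eqP; rewrite -subv0; apply/subvP => v.
rewrite memv_cap => /andP[/span_comb[k ->] vZ]; rewrite memv0 big_nat_cond.
rewrite big1 // => i; rewrite andbT /= => hi.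
by rewrite (h k vZ) ?scale0r.
Qed.

Lemma free_capI X : free X -> (<<X>> :&: Z = 0)%VS -> indep X.
Proof.
move=> fX cap k kZ; apply: (comb_free fX).
apply/eqP; rewrite -memv0 -cap memv_cap kZ andbT big_nat rpred_sum // => i hi.
by rewrite memvZ // memv_span // mem_nth.
Qed.

Lemma indep_extend X : indep X ->
  exists Y, indep (X ++ Y) /\ (size (X ++ Y) + \dim Z = n.+1)%N.
Proof.
move=> h; pose U := (<<X>> + Z)%VS; exists (vbasis (U^C)%VS).
have dXZ : directv (<<X>> + Z) by rewrite directv_addE /= !directv_trivial; apply/eqP/indep_cap.
have dim : \dim (U^C)%VS = (n.+1 - \dim U)%N by rewrite dimv_compl dim_full_rV.
have leU : (\dim U <= n.+1)%N by have := dimvS (subvf U); rewrite dim_full_rV.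
have capU : (U :&: U^C = 0)%VS by rewrite capv_compl.
have eU : (\dim U = size X + \dim Z)%N.
  by rewrite /U (directvP dXZ) /= (eqnP (indep_free h)).
split; last by rewrite size_cat size_tuple dim; lia.
have fXY : free (X ++ vbasis (U^C)%VS).
  rewrite cat_free indep_free // (basis_free (vbasisP _)) /=.
  rewrite (span_basis (vbasisP _)) directv_addE /= !directv_trivial /=.
  by rewrite -subv0; apply: subv_trans (capvS (addvSl _ Z) (subvv _)) _; rewrite capU.
apply: free_capI fXY _; rewrite span_cat (span_basis (vbasisP _)).
apply/eqP; rewrite -subv0; apply/subvP => v; rewrite memv_cap => /andP[].
move=> /memv_addP[a aX [b bU ->]] vZ.
have bU' : b \in U.
  rewrite -[b](addKr a) memvD // ?memvN; first by apply: (subvP (addvSl _ _)).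
  by apply: (subvP (addvSr _ _)).
have b0 : b = 0 by apply/eqP; rewrite -memv0 -capU memv_cap bU' bU.
by rewrite b0 addr0 in vZ *; rewrite -(indep_cap h) memv_cap aX vZ.
Qed.

Lemma center_span W : free W -> (forall z, z \in W -> z \in Z) ->
  (\dim Z <= size W)%N -> <<W>>%VS = Z.
Proof.
move=> fW WZ dW; apply/eqP; rewrite eqEdim (eqnP fW) dW andbT.
by apply/span_subvP.
Qed.

Lemma indep_complete X W : indep X -> (size X + \dim Z = n.+1)%N ->
  free W -> (forall z, z \in W -> z \in Z) ->
  exists T, [/\ (forall z, z \in T -> z \in Z), free (X ++ W ++ T) &
    size (X ++ W ++ T) = n.+1].
Proof.
move=> iX sX fW WZ; exists (tval (vbasis (Z :\: <<W>>)%VS)).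
have sWZ : (<<W>> <= Z)%VS by apply/span_subvP.
have sT := span_basis (vbasisP (Z :\: <<W>>)%VS).
have fWT : free (W ++ vbasis (Z :\: <<W>>)%VS).
  rewrite cat_free fW (basis_free (vbasisP _)) /= sT.
  rewrite directv_addE /= !directv_trivial /= capvC.
  by apply/eqP; apply: capv_diff.
have sZ : (<<W>> + (Z :\: <<W>>) = Z)%VS.
  by rewrite addvC -[RHS](addv_diff_cap Z <<W>>) (capv_idPr sWZ).
split.
- by move=> z /memv_span; rewrite sT; apply/subvP/diffvSl.
- rewrite cat_free indep_free // fWT /= span_cat sT sZ.
  by rewrite directv_addE /= !directv_trivial /=; apply/eqP/indep_cap.
- have : directv (<<W>> + (Z :\: <<W>>)).
    by rewrite directv_addE /= !directv_trivial /= capvC; apply/eqP; apply: capv_diff.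
  move/directvP; rewrite /= sZ (eqnP fW) => dZ.
  by rewrite !size_cat size_tuple -dZ.
Qed.

Lemma indep_span X v : indep X -> (size X + \dim Z = n.+1)%N ->
  exists k : nat -> R, v - \sum_(0 <= i < size X) k i *: X`_i \in Z.
Proof.
move=> iX sX; have [T [TZ fT sT]] := indep_complete iX sX (nil_free _) (fun z (h : z \in [::]) => ltac:(by [])).
have full : <<X ++ [::] ++ T>>%VS = fullv.
  by apply/eqP; rewrite eqEdim subvf (eqnP fT) sT dim_full_rV leqnn.
have := memvf v; rewrite -full span_cat => /memv_addP[a /span_comb[k ->] [b bT ->]].
exists k; rewrite addrC addKr; move: b bT; apply/subvP/span_subvP => z /=; exact: TZ.
Qed.

Lemma indep_center X p : indep X -> (size X + \dim Z = n.+1)%N ->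
  (forall i, (i < size X)%N -> br p X`_i = 0) -> p \in Z.
Proof.
move=> iX sX h; apply/(lie_centerP Hbr) => v.
have [k] := indep_span v iX sX; set s := \sum_(_ <= _ < _) _ => kZ.
rewrite -[v](subrK s) brDr // (br_centerr Hbr _ kZ) add0r /s.
rewrite br_sumr // big_nat big1 // => i hi; by rewrite brZr // h // scaler0.
Qed.

Definition rel_coef (t : nat * nat * nat) (i j : nat) : R :=
  if (i, j) == t.1 then 1 else if (j, i) == t.1 then -1 else 0.

Lemma sbr_ev l i j : (i <= n)%N -> (j <= n)%N -> i != j ->
  all (fun t => (t.1.1 <= n) && (t.1.2 <= n))%N l ->
  sbr l (ev R n i) (ev R n j) = \sum_(t <- l) rel_coef t i j *: ev R n t.2.
Proof.
move=> hi hj ij /allP hl; rewrite /sbr big_seq [RHS]big_seq; apply: eq_bigr => t /hl.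
case: t => [[a b] c] /= /andP[ha hb]; rewrite !co_ev // /rel_coef /= !xpair_eqE.
have H : ~~ [&& i == a, j == b, i == b & j == a].
  by apply: contraNN ij => /and4P[/eqP -> _ _ /eqP ->].
congr (_ *: _); move: H; rewrite (andbC (j == a)).
by case: (i == a); case: (j == b); case: (i == b); case: (j == a) => //= _; ring.
Qed.

Lemma iso_of_indep l (X W : seq V) : indep X -> (size X + \dim Z = n.+1)%N ->
  free W -> (forall z, z \in W -> z \in Z) ->
  all (fun t => [&& t.1.1 < size X, t.1.2 < size X,
                    size X <= t.2 & t.2 < size X + size W])%N l ->
  (forall i j, (i < j < size X)%N -> br X`_i X`_j =
     \sum_(t <- l) rel_coef t i j *: W`_(t.2 - size X)) ->
  two_step (sbr (R := R) (n := n) l) ->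
  lie_iso br (sbr (n := n) l).
Proof.
move=> iX sX fW WZ /allP hl hbr Hs; apply: lie_iso_sym.
have [T [TZ fB sB]] := indep_complete iX sX fW WZ.
set B := X ++ W ++ T in fB sB.
have XB : (size X + size W <= n.+1)%N.
  by have := leqnn (size B); rewrite {2}sB; apply: leq_trans; rewrite /B !size_cat; lia.
pose g (x : V) := \sum_(0 <= i < size B) co x i *: B`_i.
have gl a x y : g (a *: x + y) = a *: g x + g y.
  rewrite /g scaler_sumr -big_split /=; apply: eq_bigr => i _.
  by rewrite coD coZ scalerDl scalerA.
have g_inj : injective g.
  suff g0 x : g x = 0 -> x = 0.
    move=> x y e; apply/eqP; rewrite -subr_eq0; apply/eqP/g0.
    by rewrite addrC -scaleN1r gl e scaleN1r addNr.
  move=> e; apply: coP => i hi; rewrite co0; apply: (comb_free fB) => //.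
  by rewrite sB ltnS.
have gE j : (j <= n)%N -> g (ev R n j) = B`_j.
  move=> hj; rewrite /g sB big_mkord (bigD1 (Ordinal (hj : (j < n.+1)%N))) //=.
  rewrite co_ev // eqxx scale1r big1 ?addr0 // => i ij.
  rewrite co_ev //; last by rewrite -ltnS.
  have [e|] := eqVneq j i; last by rewrite scale0r.
  by move: ij; rewrite -val_eqE /= e eqxx.
have g0 : g 0 = 0 by have := gl (-1) 0 0; rewrite scaler0 addr0 scaleN1r addNr.
have gD x y : g (x + y) = g x + g y by have := gl 1 x y; rewrite !scale1r.
have gZ a x : g (a *: x) = a *: g x by have := gl a x 0; rewrite !addr0 g0 addr0.
have gsum (I : Type) (r : seq I) (f : I -> V) :
  g (\sum_(i <- r) f i) = \sum_(i <- r) g (f i) by apply: (big_morph g gD g0).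
have BZ i : (size X <= i)%N -> B`_i \in Z.
  move=> hi; rewrite /B nth_cat ltnNge hi /=.
  have [hs|hs] := ltnP (i - size X) (size (W ++ T)); last by rewrite nth_default // mem0v.
  by have := mem_nth 0 hs; rewrite mem_cat => /orP[/WZ|/TZ].
have key : forall i j : nat, (i < j)%N -> (j <= n)%N ->
    g (sbr l (ev R n i) (ev R n j)) = br B`_i B`_j.
  move=> i j ij hj; rewrite sbr_ev //; last first.
  - apply/allP => t /hl /and4P[h1 h2 _ _]; apply/andP; split; lia.
  - by rewrite neq_ltn ij.
  - by apply: ltnW; apply: leq_trans ij hj.
  rewrite gsum; under eq_bigr => t _ do rewrite gZ.
  have [jX|jX] := ltnP j (size X); last first.
    rewrite (br_centerr Hbr _ (BZ _ jX)) big_seq big1 // => t /hl /and4P[h1 h2 _ _].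
    rewrite /rel_coef; case: t h1 h2 => [[a b] c] /= h1 h2; rewrite !xpair_eqE.
    have -> : (j == b) = false by apply/eqP => e; move: h2; rewrite -e ltnNge jX.
    have -> : (j == a) = false by apply/eqP => e; move: h1; rewrite -e ltnNge jX.
    by rewrite andbF scale0r.
  rewrite /B !nth_cat jX (ltn_trans ij jX) hbr ?ij //.
  rewrite big_seq [RHS]big_seq; apply: eq_bigr => t /hl /and4P[_ _ h3 h4].
  rewrite gE; last by rewrite -ltnS; apply: leq_trans XB.
  rewrite /B nth_cat ltnNge h3 /= nth_cat.
  have -> // : (t.2 - size X < size W)%N by rewrite ltn_subLR.
exists g; split=> //; first exact: linear_inj_bij.
move=> x y; rewrite {1}(co_sum_ev x) {1}(co_sum_ev y) br_suml // gsum.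
rewrite {2 3}/g br_suml // sB big_mkord; apply: eq_bigr => i _.
rewrite br_sumr // gsum br_sumr // big_mkord; apply: eq_bigr => j _.
rewrite !(brZl Hs, brZr Hs, brZl Hbr, brZr Hbr) !gZ.
congr (_ *: (_ *: _)).
have [hi hj] := (ltn_ord i, ltn_ord j); rewrite !ltnS in hi hj.
have [ij|ij|ij] := ltngtP i j; first exact: key.
- rewrite (brC Hs (ev R n j)) (brC Hbr B`_j) -key // -scaleN1r gZ scaleN1r //.
- by rewrite ij !br_alt.
Qed.

End Independence.

(* [l5_rel] has an abelian ideal of codimension one and [free3_rel] is the free
   2-step nilpotent algebra on three generators. For [h3_rel], [h5_rel] and
   [l5_rel] the basis vectors that occur in no triple span an abelian direct
   factor. *)
Definition h3_rel := [:: (0, 1, 2)]%N.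
Definition h5_rel := [:: (0, 1, 4); (2, 3, 4)]%N.
Definition l5_rel := [:: (0, 1, 3); (0, 2, 4)]%N.
Definition free3_rel := [:: (0, 1, 3); (0, 2, 4); (1, 2, 5)]%N.
Definition h3h3_rel := [:: (0, 1, 4); (2, 3, 5)]%N.
Definition h3C_rel := [:: (0, 2, 4); (3, 1, 4); (0, 3, 5); (1, 2, 5)]%N.

Section ModelsTwoStep.
Variable R : realType.

Lemma h3_two_step n : (2 <= n)%N -> two_step (@sbr R n h3_rel).
Proof.
move=> hn; apply: (sbr_two_step (k := 2)); first by rewrite /graded /= hn.
  by lia.
exists (ev R n 0), (ev R n 1); move/(congr1 (fun x => co x 2)).
by rewrite /sbr !big_cons big_nil /= !(coD, coZ, co0) !co_ev //=; lra || lia.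
Qed.

Lemma h5_two_step n : (4 <= n)%N -> two_step (@sbr R n h5_rel).
Proof.
move=> hn; apply: (sbr_two_step (k := 4)); first by rewrite /graded /= hn.
  by lia.
exists (ev R n 0), (ev R n 1); move/(congr1 (fun x => co x 4)).
by rewrite /sbr !big_cons big_nil /= !(coD, coZ, co0) !co_ev //=; lra || lia.
Qed.

Lemma l5_two_step n : (4 <= n)%N -> two_step (@sbr R n l5_rel).
Proof.
move=> hn; apply: (sbr_two_step (k := 3)); first by rewrite /graded /= hn; lia.
  by lia.
exists (ev R n 0), (ev R n 1); move/(congr1 (fun x => co x 3)).
by rewrite /sbr !big_cons big_nil /= !(coD, coZ, co0) !co_ev //=; lra || lia.
Qed.

Lemma free3_two_step : two_step (@sbr R 5 free3_rel).
Proof.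
apply: (sbr_two_step (k := 3)) => //.
exists (ev R 5 0), (ev R 5 1); move/(congr1 (fun x => co x 3)).
by rewrite /sbr !big_cons big_nil /= !(coD, coZ, co0) !co_ev //=; lra.
Qed.

Lemma h3h3_two_step : two_step (@sbr R 5 h3h3_rel).
Proof.
apply: (sbr_two_step (k := 4)) => //.
exists (ev R 5 0), (ev R 5 1); move/(congr1 (fun x => co x 4)).
by rewrite /sbr !big_cons big_nil /= !(coD, coZ, co0) !co_ev //=; lra.
Qed.

Lemma h3C_two_step : two_step (@sbr R 5 h3C_rel).
Proof.
apply: (sbr_two_step (k := 4)) => //.
exists (ev R 5 0), (ev R 5 2); move/(congr1 (fun x => co x 4)).
by rewrite /sbr !big_cons big_nil /= !(coD, coZ, co0) !co_ev //=; lra.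
Qed.

End ModelsTwoStep.

Section Explicit.
Variables (R : realType) (n : nat).
Local Notation V := 'rV[R]_n.+1.
Variable br : V -> V -> V.
Hypothesis Hbr : two_step br.
Local Notation Z := (lie_center br).

Lemma indep2P x y : indep br [:: x; y] <->
  forall a b, a *: x + b *: y \in Z -> a = 0 /\ b = 0.
Proof.
split=> [h a b e|h k].
  have := h (nth 0 [:: a; b]); rewrite /index_iota /= !big_cons big_nil /= addr0.
  by move=> /(_ e) hk; split; [exact: (hk 0) | exact: (hk 1)].
rewrite /index_iota /= !big_cons big_nil /= addr0 => /h[k0 k1].
by move=> [|[|i]].
Qed.

Lemma indep3P x y u : indep br [:: x; y; u] <->
  forall a b c, a *: x + (b *: y + c *: u) \in Z -> [/\ a = 0, b = 0 & c = 0].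
Proof.
split=> [h a b c e|h k].
  have := h (nth 0 [:: a; b; c]); rewrite /index_iota /= !big_cons big_nil /= addr0.
  by move=> /(_ e) hk; split; [exact: (hk 0) | exact: (hk 1) | exact: (hk 2)].
rewrite /index_iota /= !big_cons big_nil /= addr0 => /h[k0 k1 k2].
by move=> [|[|[|i]]].
Qed.

Lemma indep4P x y u v : indep br [:: x; y; u; v] <->
  forall a b c d, a *: x + (b *: y + (c *: u + d *: v)) \in Z ->
  [/\ a = 0, b = 0, c = 0 & d = 0].
Proof.
split=> [h a b c d e|h k].
  have := h (nth 0 [:: a; b; c; d]).
  rewrite /index_iota /= !big_cons big_nil /= addr0 => /(_ e) hk.
  by split; [exact: (hk 0) | exact: (hk 1) | exact: (hk 2) | exact: (hk 3)].
rewrite /index_iota /= !big_cons big_nil /= addr0 => /h[k0 k1 k2 k3].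
by move=> [|[|[|[|i]]]].
Qed.

Lemma indep5P x y u v w : indep br [:: x; y; u; v; w] <->
  forall a b c d f, a *: x + (b *: y + (c *: u + (d *: v + f *: w))) \in Z ->
  [/\ a = 0, b = 0, c = 0, d = 0 & f = 0].
Proof.
split=> [h a b c d f e|h k].
  have := h (nth 0 [:: a; b; c; d; f]).
  rewrite /index_iota /= !big_cons big_nil /= addr0 => /(_ e) hk.
  by split; [exact: (hk 0) | exact: (hk 1) | exact: (hk 2) | exact: (hk 3)
            | exact: (hk 4)].
rewrite /index_iota /= !big_cons big_nil /= addr0 => /h[k0 k1 k2 k3 k4].
by move=> [|[|[|[|[|i]]]]].
Qed.

Lemma free2P (x y : V) : free [:: x; y] <->
  forall a b, a *: x + b *: y = 0 -> a = 0 /\ b = 0.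
Proof.
split=> [h a b e|h].
  have := comb_free h (k := nth 0 [:: a; b]).
  rewrite /index_iota /= !big_cons big_nil /= addr0.
  by move=> /(_ e) hk; split; [exact: (hk 0) | exact: (hk 1)].
apply: free_comb => k.
rewrite /index_iota /= !big_cons big_nil /= addr0 => /h[k0 k1].
by move=> [|[|i]].
Qed.

Lemma not_free3 (x y u : V) : ~~ free [:: x; y; u] -> exists a b c,
  a *: x + (b *: y + c *: u) = 0 /\ ~ [/\ a = 0, b = 0 & c = 0].
Proof.
move=> /negP nf; apply: contrapT => none; apply: nf; apply: free_comb => k.
rewrite /index_iota /= !big_cons big_nil /= addr0 => e.
have [k0 k1 k2] : [/\ k 0 = 0, k 1 = 0 & k 2 = 0].
  by apply: contrapT => h; apply: none; exists (k 0), (k 1), (k 2).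
by move=> [|[|[|i]]].
Qed.

Lemma free2I (x y : V) : x <> 0 -> (forall a, y <> a *: x) -> free [:: x; y].
Proof.
move=> x0 yx; apply/free2P => a b e.
have [b0|b0] := eqVneq b 0.
  move: e; rewrite b0 scale0r addr0 => /eqP; rewrite scaler_eq0.
  by move=> /orP[/eqP|/eqP].
exfalso; apply: (yx (- a / b)).
apply: (scalerI b0); rewrite scalerA mulrC divfK // scaleNr.
by apply/eqP; rewrite -addr_eq0 addrC; apply/eqP.
Qed.

Lemma center_span2 x y z : free [:: x; y] -> x \in Z -> y \in Z ->
  \dim Z = 2%N -> z \in Z -> exists a b, z = a *: x + b *: y.
Proof.
move=> f xZ yZ dZ; rewrite -(center_span f); last by rewrite dZ.
  move=> /span_comb[k ->]; rewrite /index_iota /= !big_cons big_nil /= addr0.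
  by exists (k 0), (k 1).
by move=> w; rewrite !inE => /orP[] /eqP ->.
Qed.

Lemma span4 x y u v p : indep br [:: x; y; u; v] -> (4 + \dim Z = n.+1)%N ->
  exists a b c d, p - (a *: x + (b *: y + (c *: u + d *: v))) \in Z.
Proof.
move=> i4 s4; have [k] := indep_span p i4 s4.
rewrite /index_iota /= !big_cons big_nil /= addr0 => h.
by exists (k 0), (k 1), (k 2), (k 3).
Qed.

Lemma center4 x y u v p : indep br [:: x; y; u; v] -> (4 + \dim Z = n.+1)%N ->
  br p x = 0 -> br p y = 0 -> br p u = 0 -> br p v = 0 -> p \in Z.
Proof.
move=> i4 s4 h1 h2 h3 h4; apply: (indep_center Hbr i4 s4).
by move=> [|[|[|[|i]]]].
Qed.

Lemma center3 x y u p : indep br [:: x; y; u] -> (3 + \dim Z = n.+1)%N ->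
  br p x = 0 -> br p y = 0 -> br p u = 0 -> p \in Z.
Proof.
move=> i4 s4 h1 h2 h3; apply: (indep_center Hbr i4 s4).
by move=> [|[|[|i]]].
Qed.

Lemma indep2_br x y : br x y <> 0 -> indep br [:: x; y].
Proof.
move=> h; apply/indep2P => a b /(lie_centerP Hbr) e.
move: (e x) (e y); rewrite !(brDl Hbr, brZl Hbr) !(br_alt Hbr) (brC Hbr x y).
rewrite !scaler0 add0r addr0 scalerN => /eqP; rewrite oppr_eq0 !scaler_eq0.
move=> h1 /eqP; rewrite scaler_eq0 => h2.
by split; [move: h2 | move: h1] => /orP[] /eqP.
Qed.

Lemma mem_br2 x y x' y' z : z \in [:: br x y; br x' y'] -> z \in Z.
Proof. by rewrite !inE => /orP[] /eqP ->; apply: center_brl. Qed.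

End Explicit.

(** * Algebras sorted by the codimension of the center *)

Section Cases.
Variables (R : realType) (n : nat).
Local Notation V := 'rV[R]_n.+1.
Variable br : V -> V -> V.
Hypothesis Hbr : two_step br.
Local Notation Z := (lie_center br).

Ltac brs := rewrite ?(brDl Hbr, brDr Hbr, brZl Hbr, brZr Hbr, brNl Hbr, brNr Hbr).

Lemma eq_mem_sub (U : {vspace V}) x y : x \in U -> x = y -> y \in U.
Proof. by move=> ? <-. Qed.

Lemma free_dim_center (W : seq V) : free W -> (forall z, z \in W -> z \in Z) ->
  (size W <= \dim Z)%N.
Proof. by move=> /eqnP <- h; apply: dimvS; apply/span_subvP. Qed.

Lemma dim_center_gt0 : (0 < \dim Z)%N.
Proof.
have [_ [x [y xy]] _] := Hbr.
have := @free_dim_center [:: br x y]; rewrite seq1_free; apply; first exact/eqP.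
by move=> z; rewrite inE => /eqP ->; apply: center_brl.
Qed.

Lemma case_h3 x y : indep br [:: x; y] -> (2 + \dim Z = n.+1)%N ->
  lie_iso br (@sbr R n h3_rel).
Proof.
move=> i2 s2; have dZ := dim_center_gt0.
have z0 : br x y <> 0.
  move=> e; have /indep2P/(_ 1 0) := i2; rewrite scale1r scale0r addr0 => h.
  have /h[/eqP] : x \in Z; last by rewrite oner_eq0.
  by apply: (indep_center Hbr i2 s2) => -[|[|i]] //= _; rewrite br_alt.
apply: (iso_of_indep Hbr i2 s2 (W := [:: br x y])).
- by rewrite seq1_free; apply/eqP.
- by move=> z; rewrite inE => /eqP ->; apply: center_brl.
- by [].
- move=> i [|[|j]] /andP[] //; case: i => [|[|i]] //= _ _.
  by rewrite big_cons big_nil /= scale1r addr0.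
- by apply: h3_two_step; lia.
Qed.

Lemma case_l5 u v w : indep br [:: u; v; w] -> (3 + \dim Z = n.+1)%N ->
  br v w = 0 -> (4 <= n)%N /\ lie_iso br (@sbr R n l5_rel).
Proof.
move=> i3 s3 vw.
(* A relation would give a combination of [v] and [w] that commutes with [u], hence with everything.
   In particular the center has dimension at least two. *)
have fW : free [:: br u v; br u w].
  apply/free2P => a b e.
  have /indep3P/(_ 0 a b) := i3; rewrite scale0r add0r.
  case=> //; apply: (center3 Hbr i3 s3); brs; rewrite ?br_alt //.
  - by rewrite (brC Hbr u v) (brC Hbr u w) !scalerN -opprD e oppr0.
  - by rewrite (brC Hbr v w) vw oppr0 !scaler0 addr0.
  - by rewrite vw !scaler0 addr0.
have dW := free_dim_center fW (mem_br2 Hbr (x := u) (y := v) (x' := u) (y' := w)).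
have n4 : (4 <= n)%N by move: dW => /=; lia.
split=> //; apply: (iso_of_indep Hbr i3 s3 fW); first exact: mem_br2.
- by [].
- move=> i [|[|[|j]]] /andP[] //; case: i => [|[|[|i]]] //= _ _; rewrite !big_cons big_nil /= ?vw;
    rewrite ?scale1r ?scale0r ?add0r ?addr0 //.
- exact: l5_two_step.
Qed.

(** Every bivector of a three-dimensional space is decomposable, so a linear relation between the
    three brackets says that two independent vectors commute. They span the abelian part required by
    [case_l5]. *)
Lemma case_dim3 u v w : indep br [:: u; v; w] -> (3 + \dim Z = n.+1)%N ->
  (n <= 5)%N -> (n = 5%N /\ lie_iso br (@sbr R n free3_rel)) \/
  ((4 <= n)%N /\ lie_iso br (@sbr R n l5_rel)).
Proof.
move=> i3 s3 n5; have /indep3P I3 := i3.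
have [f|] := boolP (free [:: br u v; br u w; br v w]).
  have mZ z : z \in [:: br u v; br u w; br v w] -> z \in Z.
    by rewrite !inE => /orP[/eqP->|/orP[] /eqP ->]; apply: center_brl.
  have := free_dim_center f mZ => /= dZ.
  have e : n = 5%N by lia.
  left; split=> //; apply: (iso_of_indep Hbr i3 s3 f) => //.
    move=> i [|[|[|j]]] /andP[] //; case: i => [|[|[|i]]] //= _ _; rewrite !big_cons big_nil /=;
    by rewrite ?scale1r ?scale0r ?add0r ?addr0.
  by rewrite e; apply: free3_two_step.
move=> /not_free3[a [b [c [e nz]]]]; right.
have [a0|a0] := eqVneq a 0; last first.
  apply: (case_l5 (u := w) (v := u - (c / a) *: w) (w := v + (b / a) *: w)) => //.
    apply/indep3P => p q r h.
    have [] := I3 q r (p - q * (c / a) + r * (b / a)).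
      by apply: eq_mem_sub h _; vec.
    by move=> q0 r0; rewrite q0 r0 mul0r mul0r subr0 addr0 => ->.
  apply: (scalerI a0); rewrite scaler0 -[RHS]e; brs.
  rewrite (brC Hbr v w) (br_alt Hbr).
  by apply/rowP => i; rewrite !mxE; field.
have [b0|b0] := eqVneq b 0; last first.
  apply: (case_l5 (u := v) (v := u + (c / b) *: v) (w := w)) => //.
    apply/indep3P => p q r h.
    have [] := I3 q (p + q * (c / b)) r.
      by apply: eq_mem_sub h _; vec.
    by move=> q0; rewrite q0 mul0r addr0 => -> ->.
  apply: (scalerI b0); rewrite scaler0 -[RHS]e a0; brs.
  by apply/rowP => i; rewrite !mxE; field.
apply: (case_l5 i3) => //.
have c0 : c != 0 by apply/eqP => c0; apply: nz.
by apply: (scalerI c0); rewrite scaler0 -[RHS]e a0 b0 !scale0r !add0r.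
Qed.

Definition rank1 (b : V -> V -> V) x := exists w, forall y, exists a, b x y = a *: w.
Definition derived1 (b : V -> V -> V) := exists w, forall x y, exists a, b x y = a *: w.

Lemma derived1_form x y : derived1 br -> br x y <> 0 ->
  exists om : V -> V -> R, forall p q, br p q = om p q *: br x y.
Proof.
move=> [w hw] xy.
have h p q : exists a, br p q = a *: br x y.
  have [[a ea] [b eb]] := (hw p q, hw x y).
  have b0 : b != 0 by apply/eqP => b0; apply: xy; rewrite eb b0 scale0r.
  by exists (a / b); rewrite eb ea scalerA divfK.
exists (fun p => projT1 (boolp.choice (h p))) => p q.
exact: (projT2 (boolp.choice (h p)) q).
Qed.

(* [u'] is the projection of [u] to the orthogonal of the hyperbolic plane
   spanned by [x] and [y]. *)
Lemma orth_proj om x y u : (forall p q, br p q = om p q *: br x y) ->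
  let u' := u - om u y *: x + om u x *: y in br u' x = 0 /\ br u' y = 0.
Proof.
move=> h /=; brs; rewrite !br_alt // (brC Hbr x y) (h u x) (h u y).
by split; vec.
Qed.

(** The bracket is an alternating form [om], nondegenerate modulo the center, and this is its
    reduction to a symplectic basis. *)
Lemma case_h5 x y u v : indep br [:: x; y; u; v] -> (4 + \dim Z = n.+1)%N ->
  derived1 br -> br x y <> 0 -> lie_iso br (@sbr R n h5_rel).
Proof.
move=> i4 s4 D1 xy; have /indep4P I4 := i4.
have [om omP] := derived1_form D1 xy.
set z := br x y in xy omP.
have := orth_proj u omP; set u' := _ + _ => -[u'x u'y].
have := orth_proj v omP; set v' := _ + _ => -[v'x v'y].
have i4' : indep br [:: x; y; u'; v'].
  apply/indep4P => a b c d h.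
  have [] := I4 (a - c * om u y - d * om v y) (b + c * om u x + d * om v x) c d.
    by apply: eq_mem_sub h _; rewrite /u' /v'; vec.
  move=> h1 h2 c0 d0; move: h1 h2; rewrite c0 d0 !mul0r !subr0 !addr0 => -> ->.
  by [].
clearbody u' v'.
have u'v' : br u' v' <> 0.
  move=> e; have /indep4P/(_ 0 0 1 0) := i4'.
  rewrite !scale0r !add0r addr0 scale1r => h.
  have /h[_ _ /eqP] : u' \in Z; last by rewrite oner_eq0.
  by apply: (center4 Hbr i4' s4) => //; rewrite br_alt.
have c0 : om u' v' != 0.
  by apply/eqP => c0; apply: u'v'; rewrite omP c0 scale0r.
have i4'' : indep br [:: x; y; u'; (om u' v')^-1 *: v'].
  apply/indep4P => a b c d h; have /indep4P/(_ a b c (d / om u' v')) := i4'.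
  rewrite -scalerA => /(_ h)[-> -> -> /eqP].
  by rewrite mulf_eq0 invr_eq0 (negPf c0) orbF => /eqP.
have dZ := dim_center_gt0.
apply: (iso_of_indep Hbr i4'' s4 (W := [:: z])).
- by rewrite seq1_free; apply/eqP.
- by move=> w; rewrite inE => /eqP ->; apply: center_brl.
- by [].
- move=> i [|[|[|[|j]]]] /andP[] //; case: i => [|[|[|[|i]]]] //= _ _; rewrite !big_cons big_nil /=; brs.
  + by rewrite scale1r scale0r !addr0.
  + by rewrite (brC Hbr u' x) u'x !scale0r !addr0 oppr0.
  + by rewrite (brC Hbr u' y) u'y !scale0r !addr0 oppr0.
  + by rewrite (brC Hbr v' x) v'x !scale0r !addr0 oppr0 scaler0.
  + by rewrite (brC Hbr v' y) v'y !scale0r !addr0 oppr0 scaler0.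
  + by rewrite (omP u' v') scalerA mulVf // scale0r add0r addr0.
- by apply: h5_two_step; lia.
Qed.

(** An alternating form on a space of odd dimension is degenerate. *)
Lemma case_dim5 x y u v w : indep br [:: x; y; u; v; w] ->
  (5 + \dim Z = n.+1)%N -> derived1 br -> br x y <> 0 -> False.
Proof.
move=> i5 s5 D1 xy; have /indep5P I5 := i5.
have [om omP] := derived1_form D1 xy.
set z := br x y in xy omP.
have := orth_proj u omP; set u' := _ + _ => -[u'x u'y].
have := orth_proj v omP; set v' := _ + _ => -[v'x v'y].
have := orth_proj w omP; set w' := _ + _ => -[w'x w'y].
have i5' : indep br [:: x; y; u'; v'; w'].
  apply/indep5P => a b c d f h.
  have [] := I5 (a - c * om u y - d * om v y - f * om w y)
                (b + c * om u x + d * om v x + f * om w x) c d f.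
    by apply: eq_mem_sub h _; rewrite /u' /v' /w'; vec.
  move=> h1 h2 c0 d0 f0; move: h1 h2.
  by rewrite c0 d0 f0 !mul0r !subr0 !addr0 => -> ->.
clearbody u' v' w'.
have /indep5P I5' := i5'.
have cen p : br p x = 0 -> br p y = 0 -> br p u' = 0 -> br p v' = 0 ->
    br p w' = 0 -> p \in Z.
  move=> h1 h2 h3 h4 h5; apply: (indep_center Hbr i5' s5).
  by move=> [|[|[|[|[|i]]]]].
(* The kernel vector of a 3 by 3 alternating matrix, given by its entries up to sign. It must be
   zero, and then [u'] itself is central. *)
have [] := I5' 0 0 (om v' w') (- om u' w') (om u' v').
  rewrite !scale0r !add0r; apply: cen; brs; rewrite ?br_alt //.
  - by rewrite u'x v'x w'x !scaler0 !addr0.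
  - by rewrite u'y v'y w'y !scaler0 !addr0.
  - by rewrite (brC Hbr u' v') (brC Hbr u' w') (omP u' v') (omP u' w'); vec.
  - by rewrite (brC Hbr v' w') (omP u' v') (omP v' w'); vec.
  - by rewrite (omP u' w') (omP v' w'); vec.
move=> _ _ _ /eqP; rewrite oppr_eq0 => /eqP uw0 uv0.
have [] := I5' 0 0 1 0 0.
  rewrite !scale0r !add0r !addr0 scale1r; apply: cen; rewrite ?br_alt //.
  - by rewrite omP uv0 scale0r.
  - by rewrite omP uw0 scale0r.
by move=> _ _ /eqP; rewrite oner_eq0.
Qed.

End Cases.

(** * Codimension four with a center of dimension two *)

Section Pencils.
Variable R : realType.
Local Notation V := 'rV[R]_6.
Variable br : V -> V -> V.
Hypothesis Hbr : two_step br.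
Local Notation Z := (lie_center br).
Hypothesis dimZ : \dim Z = 2%N.

Ltac brs := rewrite ?(brDl Hbr, brDr Hbr, brZl Hbr, brZr Hbr, brNl Hbr, brNr Hbr).

Let s4 : (4 + \dim Z = 6)%N. Proof. by rewrite dimZ. Qed.

Lemma case_h3h3 x y u v : indep br [:: x; y; u; v] -> br x y <> 0 ->
  br x u = 0 -> br x v = 0 -> (forall a, br u v <> a *: br x y) ->
  lie_iso br (@sbr R 5 h3h3_rel).
Proof.
move=> /indep4P I4 xy xu xv uvN.
have fW : free [:: br x y; br u v] by apply: free2I.
have [a [b yu]] := center_span2 fW (center_brl Hbr x y) (center_brl Hbr u v) dimZ
  (center_brl Hbr y u).
have [c [d yv]] := center_span2 fW (center_brl Hbr x y) (center_brl Hbr u v) dimZ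
  (center_brl Hbr y v).
have ux : br u x = 0 by rewrite (brC Hbr x u) xu oppr0.
have vx : br v x = 0 by rewrite (brC Hbr x v) xv oppr0.
(* The multiples of [x] cancel the components of the brackets of [y] with [u] and [v] along
   [br x y]; the terms added to [y] cancel those along [br u v]. *)
pose y' := y - d *: u + b *: v; pose u' := u + a *: x; pose v' := v + c *: x.
have i4 : indep br [:: x; y'; u'; v'].
  apply/indep4P => k1 k2 k3 k4 h.
  have [] := I4 (k1 + a * k3 + c * k4) k2 (k3 - d * k2) (k4 + b * k2).
    by apply: eq_mem_sub h _; rewrite /y' /u' /v'; vec.
  move=> h1 h2; rewrite h2 !mulr0 subr0 addr0 => h3 h4; move: h1.
  by rewrite h3 h4 !mulr0 !addr0 => ->.
apply: (iso_of_indep Hbr i4 s4 fW); first exact: mem_br2.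
- by [].
- have vu := brC Hbr u v; have yx := brC Hbr x y.
  move=> i [|[|[|[|j]]]] /andP[] //; case: i => [|[|[|[|i]]]] //= _ _;
  rewrite !big_cons big_nil /rel_coef /= /y' /u' /v'; brs;
  rewrite ?(br_alt Hbr) ?xu ?xv ?ux ?vx ?vu ?yx ?yu ?yv; vec.
- exact: h3h3_two_step.
Qed.

Lemma case_n6 x y u v : indep br [:: x; y; u; v] -> br x y <> 0 ->
  br x u = 0 -> br x v = 0 -> (exists c, br u v = c *: br x y) ->
  (forall a, br y u <> a *: br x y) ->
  lie_iso br (@sbr R 5 n6_rel).
Proof.
move=> i4 xy xu xv [c uv] yuN; have /indep4P I4 := i4.
have fW : free [:: br x y; br y u] by apply: free2I.
have [a [b yv]] := center_span2 fW (center_brl Hbr x y) (center_brl Hbr y u) dimZ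
  (center_brl Hbr y v).
have ux : br u x = 0 by rewrite (brC Hbr x u) xu oppr0.
have vx : br v x = 0 by rewrite (brC Hbr x v) xv oppr0.
have vu := brC Hbr u v; have yx := brC Hbr x y.
have uy := brC Hbr y u; have vy := brC Hbr y v.
pose v' := v - b *: u + a *: x.
have v'E : [/\ br v' x = 0, br v' y = 0, br u v' = c *: br x y & br x v' = 0].
  by split; rewrite /v'; brs;
     rewrite ?(br_alt Hbr) ?xu ?xv ?ux ?vx ?vu ?uy ?vy ?yv ?uv; vec.
have i4' : indep br [:: x; y; u; v'].
  apply/indep4P => k1 k2 k3 k4 h.
  have [] := I4 (k1 + a * k4) k2 (k3 - b * k4) k4.
    by apply: eq_mem_sub h _; rewrite /v'; vec.
  move=> h1 h2 h3 h4; move: h1 h3.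
  by rewrite h4 !mulr0 addr0 subr0 => -> ->.
move: v' v'E i4' => v' [v'x v'y uv' xv'] i4'.
have c0 : c != 0.
  apply/eqP => c0; have /indep4P/(_ 0 0 0 1) := i4'.
  rewrite !scale0r !add0r scale1r => h.
  have /h[_ _ _ /eqP] : v' \in Z; last by rewrite oner_eq0.
  apply: (center4 Hbr i4' s4) => //; last by rewrite br_alt.
  by rewrite (brC Hbr u v') uv' c0 scale0r oppr0.
(* These are X1, X2, X3, X4 in this order, with [br y u] as Z1 and [br x y] as Z2. *)
have i4'' : indep br [:: y; u; - x; c^-1 *: v'].
  apply/indep4P => k1 k2 k3 k4 h.
  have /indep4P/(_ (- k3) k1 k2 (k4 / c))[] := i4'.
    by apply: eq_mem_sub h _; vec.
  move=> /eqP; rewrite oppr_eq0 => /eqP -> -> -> /eqP.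
  by rewrite mulf_eq0 invr_eq0 (negPf c0) orbF => /eqP ->.
have fW' : free [:: br y u; br x y].
  have /free2P fW2 := fW; apply/free2P => k1 k2; rewrite addrC => /fW2[-> ->].
  by [].
apply: (iso_of_indep Hbr i4'' s4 fW'); first exact: mem_br2.
- by [].
- have yv' := brC Hbr v' y.
  move=> i [|[|[|[|j]]]] /andP[] //; case: i => [|[|[|[|i]]]] //= _ _;
  rewrite !big_cons big_nil /rel_coef /=; brs;
  rewrite ?ux ?xv' ?yv' ?v'y ?yx ?uv'; apply/rowP => i'; rewrite !mxE;
  by field.
- exact: n6_two_step.
Qed.

(** The kernel of [ad x] is a hyperplane, so a basis modulo the center can be completed by [u] and
    [v] commuting with [x]. The cases record which bracket among [u], [v], [y] first leaves the line
    of [br x y]; if none does, the derived algebra is a line. *)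
Lemma case_rank1 x : x \notin Z -> rank1 br x -> ~ derived1 br ->
  lie_iso br (@sbr R 5 h3h3_rel) \/ lie_iso br (@sbr R 5 n6_rel).
Proof.
move=> xZ [w hw] nD.
have [y xy] : exists y, br x y <> 0.
  apply: contrapT => none; move/negP: xZ; apply; apply/(lie_centerP Hbr) => y.
  by apply: contrapT => h; apply: none; exists y.
have xm p : exists a, br x p = a *: br x y.
  have [[a ea] [b eb]] := (hw p, hw y).
  have b0 : b != 0 by apply/eqP => b0; apply: xy; rewrite eb b0 scale0r.
  by exists (a / b); rewrite eb ea scalerA divfK.
have [Y [iY sY]] := indep_extend (indep2_br Hbr xy).
have [u0 [v0 eY]] : exists u0 v0, Y = [:: u0; v0].
  by move: sY; rewrite dimZ; case: Y {iY} => [|u0 [|v0 [|t Y]]] //=; [exists u0, v0|lia].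
rewrite {}eY /= in iY {sY}; have /indep4P I4 := iY.
have [[a xu0] [b xv0]] := (xm u0, xm v0).
pose u := u0 - a *: y; pose v := v0 - b *: y.
have i4 : indep br [:: x; y; u; v].
  apply/indep4P => k1 k2 k3 k4 h.
  have [] := I4 k1 (k2 - a * k3 - b * k4) k3 k4.
    by apply: eq_mem_sub h _; rewrite /u /v; vec.
  by move=> -> h2 h3 h4; move: h2; rewrite h3 h4 !mulr0 !subr0 => ->.
have xu : br x u = 0 by rewrite /u; brs; rewrite xu0 subrr.
have xv : br x v = 0 by rewrite /v; brs; rewrite xv0 subrr.
move: u v i4 xu xv {I4 iY xu0 xv0} => u v i4 xu xv.
have [[c uv]|uvN] := pselect (exists c, br u v = c *: br x y); last first.
  by left; apply: (case_h3h3 i4) => // c e; apply: uvN; exists c.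
right; have [[d yu]|yuN] := pselect (exists d, br y u = d *: br x y); last first.
  by apply: (case_n6 i4) => //; [exists c | move=> d e; apply: yuN; exists d].
have [[e yv]|yvN] := pselect (exists e, br y v = e *: br x y); last first.
  apply: (@case_n6 x y v u) => //.
  - apply/indep4P => k1 k2 k3 k4 h; have /indep4P/(_ k1 k2 k4 k3)[] := i4.
      by apply: eq_mem_sub h _; vec.
    by move=> -> -> -> ->.
  - by exists (- c); rewrite (brC Hbr u v) uv scaleNr.
  - by move=> e h; apply: yvN; exists e.
exfalso; apply: nD; exists (br x y) => p q.
have [p1 [p2 [p3 [p4 hp]]]] := span4 p i4 s4.
have [q1 [q2 [q3 [q4 hq]]]] := span4 q i4 s4.
have [z zZ ep] : exists2 z, z \in Z & p = z + (p1 *: x + (p2 *: y + (p3 *: u + p4 *: v))).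
  by eexists; first exact: hp; rewrite subrK.
have [t tZ eq] : exists2 z, z \in Z & q = z + (q1 *: x + (q2 *: y + (q3 *: u + q4 *: v))).
  by eexists; first exact: hq; rewrite subrK.
rewrite ep eq (brDl Hbr) (br_centerl Hbr _ zZ) add0r (brDr Hbr) (br_centerr Hbr _ tZ) add0r.
brs; rewrite !(br_alt Hbr) (brC Hbr x u) (brC Hbr x v) (brC Hbr u v) (brC Hbr x y).
rewrite (brC Hbr y u) (brC Hbr y v) xu xv yu yv uv.
exists (p1 * q2 - p2 * q1 + p2 * q3 * d - p3 * q2 * d + p2 * q4 * e - p4 * q2 * e
        + p3 * q4 * c - p4 * q3 * c).
vec.
Qed.

(** Here [ad u] is [A] after [ad x] on the span of [y] and [w], where [A] acts on the center with
    characteristic polynomial X^2 - t X + d. Its roots are al + be i and al - be i, so [u'] and [w']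
    become i x and i y. *)
Lemma case_h3C x u y w (t d : R) : indep br [:: x; u; y; w] ->
  free [:: br x y; br u y] ->
  br x u = 0 -> br y w = 0 -> br x w = br u y ->
  br u w = t *: br u y - d *: br x y -> t ^+ 2 < 4 * d ->
  lie_iso br (@sbr R 5 h3C_rel).
Proof.
move=> /indep4P I4 fW xu yw xw uw td.
pose al := t / 2; pose be := Num.sqrt (d - al ^+ 2).
have be2 : be ^+ 2 = d - al ^+ 2.
  by rewrite sqr_sqrtr // /al; nra.
have be0 : be != 0.
  by apply/eqP => be0; move: be2; rewrite be0 /al; nra.
pose u' := be^-1 *: (u - al *: x); pose w' := be^-1 *: (w - al *: y).
have i4 : indep br [:: x; u'; y; w'].
  apply/indep4P => k1 k2 k3 k4 h.
  have [] := I4 (k1 - al / be * k2) (k2 / be) (k3 - al / be * k4) (k4 / be).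
    by apply: eq_mem_sub h _; rewrite /u' /w'; vec.
  move=> h1 /eqP; rewrite mulf_eq0 invr_eq0 (negPf be0) orbF => /eqP h2 h3 /eqP.
  rewrite mulf_eq0 invr_eq0 (negPf be0) orbF => /eqP h4.
  by move: h1 h3; rewrite h2 h4 !mulr0 !subr0 => -> ->.
have fW' : free [:: br x y; br x w'].
  have /free2P F := fW; apply/free2P => k1 k2.
  rewrite /w'; brs; rewrite xw => e.
  have [] := F (k1 - al / be * k2) (k2 / be); first by rewrite -[RHS]e; vec.
  move=> h1 /eqP; rewrite mulf_eq0 invr_eq0 (negPf be0) orbF => /eqP h2.
  by move: h1; rewrite h2 mulr0 subr0.
apply: (iso_of_indep Hbr i4 s4 fW'); first exact: mem_br2.
- by [].
- have yx := brC Hbr x y; have ux := brC Hbr x u.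
  move=> i [|[|[|[|j]]]] /andP[] //; case: i => [|[|[|[|i]]]] //= _ _;
  rewrite !big_cons big_nil /rel_coef /= /u' /w'; brs;
  rewrite ?(br_alt Hbr) ?yx ?ux ?xu ?yw ?xw ?uw; apply/rowP => i'; rewrite !mxE; try ring.
  have -> : t = 2 * al by rewrite /al; field.
  have -> : d = be ^+ 2 + al ^+ 2 by rewrite be2 subrK.
  by field.
- exact: h3C_two_step.
Qed.

(** For dimension reasons some [u] independent of [x] commutes with [x]. A real eigenvalue [l] of
    the pencil of [ad x] and [ad u] would make [ad (u - l *: x)] of rank one, so the pencil has
    none. *)
Lemma case_rank2 : (forall x, rank1 br x -> x \in Z) ->
  lie_iso br (@sbr R 5 h3C_rel).
Proof.
move=> noR.
have [_ [x [y0 xy0]] _] := Hbr.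
have xZ : x \notin Z by apply/negP => /(lie_centerP Hbr)/(_ y0).
have i1 : indep br [:: x].
  move=> k; rewrite /index_iota /= big_cons big_nil addr0 /= => h [|i] // _.
  apply/eqP; apply: contraNT xZ => k0.
  by rewrite -(scale1r x) -(mulVf k0) -scalerA memvZ.
have [Y [iY sY]] := indep_extend i1.
have [a [b [c eY]]] : exists a b c, Y = [:: a; b; c].
  move: sY; rewrite dimZ; case: Y {iY} => [|a [|b [|c [|e Y]]]] //=; first by exists a, b, c.
  by lia.
rewrite {}eY /= in iY {sY}; have /indep4P I4 := iY.
have nf : ~~ free [:: br x a; br x b; br x c].
  apply/negP => f; suff : (3 <= \dim Z)%N by rewrite dimZ.
  apply: (free_dim_center f) => z.
  by rewrite !inE => /orP[/eqP->|/orP[] /eqP ->]; apply: center_brl.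
have [k1 [k2 [k3 [ek nk]]]] := not_free3 nf.
pose u := k1 *: a + (k2 *: b + k3 *: c).
have xu : br x u = 0 by rewrite /u; brs.
have i2 l1 l2 : l1 *: x + l2 *: u \in Z -> l1 = 0 /\ l2 = 0.
  move=> h; have [] := I4 l1 (l2 * k1) (l2 * k2) (l2 * k3).
    by apply: eq_mem_sub h _; rewrite /u; vec.
  move=> -> h1 h2 h3; split=> //; apply/eqP; apply: contraT => l20; exfalso.
  by apply: nk; split; apply: (mulfI l20); rewrite mulr0.
have ux : br u x = 0 by rewrite (brC Hbr x u) xu oppr0.
clearbody u => {I4 iY nf ek nk a b c k1 k2 k3}.
have nR : ~ rank1 br x by move/noR; apply/negP.
have [y xy] : exists y, br x y <> 0 by exists y0.
have [w0 xw0] : exists w, forall a, br x w <> a *: br x y.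
  apply: contrapT => none; apply: nR; exists (br x y) => p.
  apply: contrapT => np; apply: none; exists p => a e; apply: np; by exists a.
have fxy : free [:: br x y; br x w0] by apply: free2I.
have mkI w : free [:: br x y; br x w] -> indep br [:: x; u; y; w].
  move=> /free2P f; apply/indep4P => l1 l2 l3 l4 h.
  have [h3 h4] : l3 = 0 /\ l4 = 0.
    apply: f; move/(br_centerr Hbr x): (h); brs.
    by rewrite (br_alt Hbr) xu !scaler0 !add0r.
  have [] := i2 l1 l2; last by move=> -> ->.
  by move: h; rewrite h3 h4 !scale0r !addr0.
(* [u - l *: x] commutes with [x] and [u], so proportional brackets with [y] and [w] bound its rank
   by one and force it to be central. *)
have R1 l w : indep br [:: x; u; y; w] ->
    (exists t, br (u - l *: x) w = t *: br (u - l *: x) y \/ br (u - l *: x) y = t *: br (u - l *: x) w) -> False.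
  move=> iw [t ht].
  have : u - l *: x \in Z.
    have sp p : exists2 e, True & exists e', br (u - l *: x) p =
        e *: br (u - l *: x) y + e' *: br (u - l *: x) w.
      have [q1 [q2 [q3 [q4 hq]]]] := span4 p iw s4.
      exists q3 => //; exists q4; move/(br_centerr Hbr (u - l *: x)): hq.
      rewrite (brBr Hbr) => /eqP; rewrite subr_eq0 => /eqP ->.
      rewrite !(brDr Hbr) !(brZr Hbr).
      have -> : br (u - l *: x) x = 0 by brs; rewrite ux (br_alt Hbr) scaler0 subrr.
      have -> : br (u - l *: x) u = 0 by brs; rewrite xu (br_alt Hbr) scaler0 subrr.
      by rewrite !scaler0 !add0r.
    apply: noR; case: ht => ht.
      exists (br (u - l *: x) y) => p; have [e _ [e' ->]] := sp p.
      by exists (e + e' * t); rewrite ht scalerDl scalerA.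
    exists (br (u - l *: x) w) => p; have [e _ [e' ->]] := sp p.
    by exists (e * t + e'); rewrite ht scalerDl scalerA.
  move=> h; have [] := i2 (- l) 1; last by move=> _ /eqP; rewrite oner_eq0.
  by apply: eq_mem_sub h _; rewrite scale1r addrC scaleNr.
have uyN a : br u y <> a *: br x y.
  move=> e; apply: (R1 a w0 (mkI _ fxy)); exists 0; right.
  by brs; rewrite e subrr scale0r.
have fW : free [:: br x y; br u y] by apply: free2I.
have [a1 [b1 uyE]] := center_span2 fxy (center_brl Hbr x y) (center_brl Hbr x w0)
  dimZ (center_brl Hbr u y).
pose w1 := a1 *: y + b1 *: w0.
have xw1 : br x w1 = br u y by rewrite uyE /w1; brs.
clearbody w1 => {a1 b1 uyE w0 xw0 fxy}.
have [a2 [b2 yw1]] := center_span2 fW (center_brl Hbr x y) (center_brl Hbr u y)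
  dimZ (center_brl Hbr y w1).
(* Adding multiples of [x] and [u] does not change the bracket with [x] and cancels that with
   [y]. *)
pose w := w1 + a2 *: x + b2 *: u.
have xw : br x w = br u y.
  by rewrite /w; brs; rewrite (br_alt Hbr) xu xw1 !scaler0 !addr0.
have yw : br y w = 0.
  by rewrite /w; brs; rewrite yw1 (brC Hbr x y) (brC Hbr u y); vec.
clearbody w => {a2 b2 yw1 w1 xw1}.
have fxw : free [:: br x y; br x w] by rewrite xw.
have iw := mkI _ fxw.
have [d [t uw]] := center_span2 fW (center_brl Hbr x y) (center_brl Hbr u y)
  dimZ (center_brl Hbr u w).
apply: (case_h3C (t := t) (d := - d) iw fW) => //.
  by rewrite uw scaleNr opprK addrC.
rewrite ltNge; apply/negP => h.
pose s := Num.sqrt (t ^+ 2 + 4 * d).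
have s2 : s ^+ 2 = t ^+ 2 + 4 * d by rewrite sqr_sqrtr //; lra.
(* A real eigenvalue: a root of X^2 - t X - d, since [d] has here the opposite sign to that of
   [case_h3C]. *)
pose l := (t + s) / 2.
have ld : d = l ^+ 2 - t * l by rewrite /l; nra.
apply: (R1 l w iw); exists (t - l); left.
by brs; rewrite uw xw ld; vec.
Qed.

End Pencils.

(* The first component of a model is its dimension minus one. *)
Definition models : seq (nat * seq (nat * nat * nat)) :=
  [:: (2, h3_rel); (3, h3_rel); (4, h3_rel); (4, h5_rel); (4, l5_rel);
      (5, h3_rel); (5, h5_rel); (5, l5_rel); (5, free3_rel); (5, h3h3_rel);
      (5, h3C_rel); (5, n6_rel)]%N.

Section Classification.
Variable R : realType.

Lemma models_two_step n l : (n, l) \in models -> two_step (@sbr R n l).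
Proof.
rewrite !inE => /orP[|]; first by case/eqP => -> ->; apply: h3_two_step.
do 10! [case/orP; first by case/eqP => -> ->; first
  [exact: h3_two_step | exact: h5_two_step | exact: l5_two_step
  | exact: free3_two_step | exact: h3h3_two_step | exact: h3C_two_step]].
by case/eqP => -> ->; apply: n6_two_step.
Qed.

Lemma h3_models n : (2 <= n <= 5)%N -> (n, h3_rel) \in models.
Proof. by move: n => [|[|[|[|[|[|n]]]]]]. Qed.

Lemma h5_models n : (4 <= n <= 5)%N -> (n, h5_rel) \in models.
Proof. by move: n => [|[|[|[|[|[|n]]]]]]. Qed.

Lemma l5_models n : (4 <= n <= 5)%N -> (n, l5_rel) \in models.
Proof. by move: n => [|[|[|[|[|[|n]]]]]]. Qed.

Lemma dim1_derived1 n (br : 'rV[R]_n.+1 -> 'rV[R]_n.+1 -> 'rV[R]_n.+1) x y :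
  two_step br -> \dim (lie_center br) = 1%N -> br x y <> 0 -> derived1 br.
Proof.
move=> Hbr d1 xy; exists (br x y) => p q.
have f : free [:: br x y] by rewrite seq1_free; apply/eqP.
have := center_brl Hbr p q; rewrite -(center_span f) ?d1 //.
  by rewrite span_seq1 => /vlineP.
by move=> z; rewrite inE => /eqP ->; apply: center_brl.
Qed.

Lemma classification n (br : 'rV[R]_n.+1 -> 'rV[R]_n.+1 -> 'rV[R]_n.+1) :
  (n <= 5)%N -> two_step br ->
  exists l, (n, l) \in models /\ lie_iso br (@sbr R n l).
Proof.
move=> n5 Hbr; have dZ := dim_center_gt0 Hbr.
have [_ [x [y xy]] _] := Hbr.
have [Y [iX sX]] := indep_extend (indep2_br Hbr xy).
(* The codimension of the center is two plus the length of [Y]; six or more is excluded because the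
   center is not zero. *)
case: Y iX sX => [|u [|v [|w [|t Y]]]] /= iX sX; last by lia.
- exists h3_rel; split; last exact: (case_h3 Hbr iX).
  by apply: h3_models; lia.
- have [[n5' h]|[n4 h]] := case_dim3 Hbr iX sX n5.
    by exists free3_rel; split=> //; rewrite n5'.
  by exists l5_rel; split=> //; apply: l5_models; rewrite n4.
- have [D1|nD] := pselect (derived1 br).
    exists h5_rel; split; last exact: (case_h5 Hbr iX sX D1 xy).
    by apply: h5_models; lia.
  have d2 : \dim (lie_center br) = 2%N.
    have [d1|] := eqVneq (\dim (lie_center br)) 1%N; last by lia.
    by case: nD; apply: (dim1_derived1 Hbr d1 xy).
  have e5 : n = 5%N by lia.
  move: br Hbr nD d2 {dZ iX sX x y u v xy n5}; rewrite {}e5 => br Hbr nD d2.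
  have [[x [xZ x1]]|none] :=
      pselect (exists x, x \notin lie_center br /\ rank1 br x).
    have [h|h] := case_rank1 Hbr d2 xZ x1 nD.
      by exists h3h3_rel.
    by exists n6_rel.
  exists h3C_rel; split=> //; apply: (case_rank2 Hbr d2) => x x1.
  by apply: contraT => xZ; case: none; exists x.
- exfalso; apply: (case_dim5 Hbr iX sX _ xy).
  by apply: (dim1_derived1 Hbr _ xy); lia.
Qed.

End Classification.

(** * Partial automatic continuity of the models *)

Lemma good_spanned_iso (R : realType) n m
  (b : 'rV[R]_n -> 'rV[R]_n -> 'rV[R]_n) (b' : 'rV[R]_m -> 'rV[R]_m -> 'rV[R]_m) :
  lie_iso b b' -> good_spanned b -> good_spanned b'.
Proof.
move=> [f [fl [g fK gK] fb]] hs.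
have f0 : f 0 = 0 by have := fl (-1) 0 0; rewrite scaler0 addr0 scaleN1r addNr.
have fD x y : f (x + y) = f x + f y by have := fl 1 x y; rewrite !scale1r.
have fZ a x : f (a *: x) = a *: f x by have := fl a x 0; rewrite !addr0 f0 addr0.
have fN x : f (- x) = - f x by rewrite -scaleN1r fZ scaleN1r.
have fb0 x y : (b x y = 0) <-> (b' (f x) (f y) = 0).
  by rewrite -fb -f0; split=> [->|/(can_inj fK)].
have gd x : good b x -> good b' (f x).
  move=> gx y hy; have [|a ha] := gx (g y).
    by move=> w /fb0 h; apply/fb0; rewrite gK; apply: hy.
  exists a => w; rewrite -(gK w) -{1}(gK y) -fZ -fN -fD; exact/fb0.
move=> v; have [r [hr hv]] := hs (g v).
exists [seq (p.1, f p.2) | p <- r]; split.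
  move=> _ /mapP[p /hr[y [h1 h2 h3]] ->]; exists (f y); split=> /=; try exact: gd.
  by move/fb0.
move=> w; rewrite big_map /=; set s := \sum_(_ <- _) _.
have -> : s = f (\sum_(p <- r) p.1 *: p.2).
  by rewrite (big_morph f fD f0); apply: eq_bigr => p _; rewrite fZ.
by rewrite -(gK w) -{1}(gK v) -fN -fD; apply/fb0.
Qed.

Section ModelsGood.
Variable R : realType.

Lemma graded_good n l k (x : 'rV[R]_n.+1) : graded n l k ->
  (forall y, (forall w, sbr l x w = 0 -> sbr l y w = 0) ->
    exists a, forall i, (i < k)%N -> co y i = a * co x i) ->
  good (sbr l) x.
Proof.
move=> lk h y /h[a ha]; exists a => w; apply: (sbr_low _ lk) => i /ha e.
by rewrite coD coN coZ e subrr.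
Qed.

Lemma graded_spanned n l k (Y : seq 'rV[R]_n.+1) : graded n l k ->
  (forall x, x \in Y -> exists y, good_pair (sbr l) x y) ->
  (forall v : 'rV[R]_n.+1, exists c : nat -> R, forall i, (i < k)%N ->
    co v i = \sum_(0 <= j < size Y) c j * co Y`_j i) ->
  good_spanned (sbr (R := R) (n := n) l).
Proof.
move=> lk hY hv v; have [c hc] := hv v.
exists [seq (c j, Y`_j) | j <- index_iota 0 (size Y)]; split.
  move=> p /mapP[j hj ->]; rewrite mem_index_iota /= in hj.
  by apply: hY; apply: mem_nth.
move=> w; apply: (sbr_low _ lk) => i /hc e.
rewrite big_map coD coN e co_sum; apply/eqP; rewrite subr_eq0; apply/eqP.
by apply: eq_bigr => j _; rewrite coZ.
Qed.

(** [h] says that what commutes with [x] commutes with [y]; the tactic applies it to [w] and keeps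
    the equation on [y] found in coordinate [k]. *)
Ltac use_comm h w k := let H := fresh in let H0 := fresh in
  assert (H := h w);
  match type of H with ?A -> _ => assert (H0 : A); [by sbr_zero|] end;
  specialize (H H0); clear H0; sbr_at k H; clear H; move=> ?.

Ltac coords := move=> [|[|[|[|?]]]] //= _; rewrite ?coD !co_ev //=; try lia; try lra.

Lemma h3_good n : (2 <= n)%N -> good_spanned (@sbr R n h3_rel).
Proof.
move=> hn; have lk : graded n h3_rel 2 by rewrite /graded /= hn.
have g0 : good (sbr h3_rel) (ev R n 0).
  apply: (graded_good lk) => y h; use_comm h (ev R n 0) 2%N.
  by exists (co y 0); coords.
have g1 : good (sbr h3_rel) (ev R n 1).
  apply: (graded_good lk) => y h; use_comm h (ev R n 1) 2%N.
  by exists (co y 1); coords.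
have nz : sbr h3_rel (ev R n 0) (ev R n 1) <> 0.
  by move=> e; sbr_at 2%N e; lra.
have nz' : sbr h3_rel (ev R n 1) (ev R n 0) <> 0.
  by move=> e; sbr_at 2%N e; lra.
apply: (graded_spanned (Y := [:: ev R n 0; ev R n 1]) lk).
  by move=> x; rewrite !inE => /orP[] /eqP ->; [exists (ev R n 1) | exists (ev R n 0)].
move=> v; exists (fun j => co v j) => i.
by rewrite /index_iota /= !big_cons big_nil /=; move: i; coords.
Qed.

Lemma h5_good n : (4 <= n)%N -> good_spanned (@sbr R n h5_rel).
Proof.
move=> hn; have lk : graded n h5_rel 4 by rewrite /graded /= hn.
have g0 : good (sbr h5_rel) (ev R n 0).
  apply: (graded_good lk) => y h; use_comm h (ev R n 0) 4%N.
  use_comm h (ev R n 2) 4%N; use_comm h (ev R n 3) 4%N.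
  by exists (co y 0); coords.
have g1 : good (sbr h5_rel) (ev R n 1).
  apply: (graded_good lk) => y h; use_comm h (ev R n 1) 4%N.
  use_comm h (ev R n 2) 4%N; use_comm h (ev R n 3) 4%N.
  by exists (co y 1); coords.
have g2 : good (sbr h5_rel) (ev R n 2).
  apply: (graded_good lk) => y h; use_comm h (ev R n 2) 4%N.
  use_comm h (ev R n 0) 4%N; use_comm h (ev R n 1) 4%N.
  by exists (co y 2); coords.
have g3 : good (sbr h5_rel) (ev R n 3).
  apply: (graded_good lk) => y h; use_comm h (ev R n 3) 4%N.
  use_comm h (ev R n 0) 4%N; use_comm h (ev R n 1) 4%N.
  by exists (co y 3); coords.
have n01 : sbr h5_rel (ev R n 0) (ev R n 1) <> 0.
  by move=> e; sbr_at 4%N e; lra.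
have n10 : sbr h5_rel (ev R n 1) (ev R n 0) <> 0.
  by move=> e; sbr_at 4%N e; lra.
have n23 : sbr h5_rel (ev R n 2) (ev R n 3) <> 0.
  by move=> e; sbr_at 4%N e; lra.
have n32 : sbr h5_rel (ev R n 3) (ev R n 2) <> 0.
  by move=> e; sbr_at 4%N e; lra.
apply: (graded_spanned (Y := [:: ev R n 0; ev R n 1; ev R n 2; ev R n 3]) lk).
  move=> x; rewrite !inE => /or4P[] /eqP ->;
  by [exists (ev R n 1) | exists (ev R n 0) | exists (ev R n 3) | exists (ev R n 2)].
move=> v; exists (fun j => co v j) => i.
by rewrite /index_iota /= !big_cons big_nil /=; move: i; coords.
Qed.

Lemma h3h3_good : good_spanned (@sbr R 5 h3h3_rel).
Proof.
have lk : graded 5 h3h3_rel 4 by [].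
have g0 : good (sbr h3h3_rel) (ev R 5 0).
  apply: (graded_good lk) => y h; use_comm h (ev R 5 0) 4%N.
  use_comm h (ev R 5 2) 5%N; use_comm h (ev R 5 3) 5%N.
  by exists (co y 0); coords.
have g1 : good (sbr h3h3_rel) (ev R 5 1).
  apply: (graded_good lk) => y h; use_comm h (ev R 5 1) 4%N.
  use_comm h (ev R 5 2) 5%N; use_comm h (ev R 5 3) 5%N.
  by exists (co y 1); coords.
have g2 : good (sbr h3h3_rel) (ev R 5 2).
  apply: (graded_good lk) => y h; use_comm h (ev R 5 2) 5%N.
  use_comm h (ev R 5 0) 4%N; use_comm h (ev R 5 1) 4%N.
  by exists (co y 2); coords.
have g3 : good (sbr h3h3_rel) (ev R 5 3).
  apply: (graded_good lk) => y h; use_comm h (ev R 5 3) 5%N.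
  use_comm h (ev R 5 0) 4%N; use_comm h (ev R 5 1) 4%N.
  by exists (co y 3); coords.
have n01 : sbr h3h3_rel (ev R 5 0) (ev R 5 1) <> 0.
  by move=> e; sbr_at 4%N e; lra.
have n10 : sbr h3h3_rel (ev R 5 1) (ev R 5 0) <> 0.
  by move=> e; sbr_at 4%N e; lra.
have n23 : sbr h3h3_rel (ev R 5 2) (ev R 5 3) <> 0.
  by move=> e; sbr_at 5%N e; lra.
have n32 : sbr h3h3_rel (ev R 5 3) (ev R 5 2) <> 0.
  by move=> e; sbr_at 5%N e; lra.
apply: (graded_spanned (Y := [:: ev R 5 0; ev R 5 1; ev R 5 2; ev R 5 3]) lk).
  move=> x; rewrite !inE => /or4P[] /eqP ->;
  by [exists (ev R 5 1) | exists (ev R 5 0) | exists (ev R 5 3) | exists (ev R 5 2)].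
move=> v; exists (fun j => co v j) => i.
by rewrite /index_iota /= !big_cons big_nil /=; move: i; coords.
Qed.

(* [ev 1] and [ev 2] are not good: they have the same centralizer. *)
Lemma l5_good n : (4 <= n)%N -> good_spanned (@sbr R n l5_rel).
Proof.
move=> hn; have lk : graded n l5_rel 3 by rewrite /graded /=; lia.
have g0 : good (sbr l5_rel) (ev R n 0).
  apply: (graded_good lk) => y h; use_comm h (ev R n 0) 3%N.
  use_comm h (ev R n 0) 4%N.
  by exists (co y 0); coords.
have g1 : good (sbr l5_rel) (ev R n 0 + ev R n 1).
  apply: (graded_good lk) => y h; use_comm h (ev R n 0 + ev R n 1) 3%N.
  use_comm h (ev R n 0 + ev R n 1) 4%N.
  by exists (co y 0); coords.
have g2 : good (sbr l5_rel) (ev R n 0 + ev R n 2).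
  apply: (graded_good lk) => y h; use_comm h (ev R n 0 + ev R n 2) 3%N.
  use_comm h (ev R n 0 + ev R n 2) 4%N.
  by exists (co y 0); coords.
have n01 : sbr l5_rel (ev R n 0) (ev R n 0 + ev R n 1) <> 0.
  by move=> e; sbr_at 3%N e; lra.
have n10 : sbr l5_rel (ev R n 0 + ev R n 1) (ev R n 0) <> 0.
  by move=> e; sbr_at 3%N e; lra.
have n20 : sbr l5_rel (ev R n 0 + ev R n 2) (ev R n 0) <> 0.
  by move=> e; sbr_at 4%N e; lra.
apply: (graded_spanned (Y := [:: ev R n 0; ev R n 0 + ev R n 1; ev R n 0 + ev R n 2]) lk).
  move=> x; rewrite !inE => /or3P[] /eqP ->;
  by [exists (ev R n 0 + ev R n 1) | exists (ev R n 0) | exists (ev R n 0)].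
move=> v; exists (nth 0 [:: co v 0 - co v 1 - co v 2; co v 1; co v 2]) => i.
by rewrite /index_iota /= !big_cons big_nil /=; move: i; coords.
Qed.

Lemma free3_good : good_spanned (@sbr R 5 free3_rel).
Proof.
have lk : graded 5 free3_rel 3 by [].
have g0 : good (sbr free3_rel) (ev R 5 0).
  apply: (graded_good lk) => y h; use_comm h (ev R 5 0) 3%N.
  use_comm h (ev R 5 0) 4%N.
  by exists (co y 0); coords.
have g1 : good (sbr free3_rel) (ev R 5 1).
  apply: (graded_good lk) => y h; use_comm h (ev R 5 1) 3%N.
  use_comm h (ev R 5 1) 5%N.
  by exists (co y 1); coords.
have g2 : good (sbr free3_rel) (ev R 5 2).
  apply: (graded_good lk) => y h; use_comm h (ev R 5 2) 4%N.
  use_comm h (ev R 5 2) 5%N.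
  by exists (co y 2); coords.
have n01 : sbr free3_rel (ev R 5 0) (ev R 5 1) <> 0.
  by move=> e; sbr_at 3%N e; lra.
have n10 : sbr free3_rel (ev R 5 1) (ev R 5 0) <> 0.
  by move=> e; sbr_at 3%N e; lra.
have n20 : sbr free3_rel (ev R 5 2) (ev R 5 0) <> 0.
  by move=> e; sbr_at 4%N e; lra.
apply: (graded_spanned (Y := [:: ev R 5 0; ev R 5 1; ev R 5 2]) lk).
  move=> x; rewrite !inE => /or3P[] /eqP ->;
  by [exists (ev R 5 1) | exists (ev R 5 0) | exists (ev R 5 0)].
move=> v; exists (fun j => co v j) => i.
by rewrite /index_iota /= !big_cons big_nil /=; move: i; coords.
Qed.

(** Real and imaginary parts are interleaved, which is the basis in which [h3C_rel] expresses the
    complex Heisenberg bracket. *)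
Definition of_complex (z : 'rV[R[i]]_3) : 'rV[R]_6 :=
  \row_k (if odd k then @complex.Im R else @complex.Re R) (z 0 (inord k./2)).

Definition to_complex (x : 'rV[R]_6) : 'rV[R[i]]_3 :=
  \row_l (co x l.*2 +i* co x l.*2.+1)%C.

Lemma co_of_complex z k : (k <= 5)%N ->
  co (of_complex z) k = (if odd k then @complex.Im R else @complex.Re R) (z 0 (inord k./2)).
Proof. by move=> hk; rewrite /co mxE inordK. Qed.

Lemma of_complexK : cancel of_complex to_complex.
Proof.
move=> z; apply/rowP => l; rewrite mxE.
have hl : (l < 3)%N := ltn_ord l.
rewrite !co_of_complex; try lia.
rewrite /= odd_double doubleK uphalf_double /= inord_val.
by case: (z 0 l).
Qed.

Lemma to_complexK : cancel to_complex of_complex.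
Proof.
move=> x; apply: coP => k hk; rewrite co_of_complex // mxE inordK; last by lia.
by move: k hk => [|[|[|[|[|[|k]]]]]].
Qed.

Lemma of_complex_linear (a : R) z w :
  of_complex ((a%:C)%C *: z + w) = a *: of_complex z + of_complex w.
Proof.
apply/rowP => k; rewrite !mxE; case: (z 0 _) => zr zi; case: (w 0 _) => wr wi.
by case: (odd k) => /=; ring.
Qed.

Lemma of_complex_br z w :
  of_complex (cbracket (@heis_const R) z w) =
  sbr h3C_rel (of_complex z) (of_complex w).
Proof.
rewrite cbrE.
rewrite /sbr !big_cons big_nil /= !co_of_complex //=.
have i0 : inord 0 = Ordinal (isT : (0 < 3)%N) by apply/val_inj; rewrite /= inordK.
have i1 : inord 1 = Ordinal (isT : (1 < 3)%N) by apply/val_inj; rewrite /= inordK.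
rewrite i0 i1; case: (z 0 _) => a b; case: (w 0 _) => c d.
case: (w 0 _) => a' b'; case: (z 0 _) => c' d' /=.
apply: coP => k hk; rewrite co_of_complex // !(coD, coZ, co0) !co_ev // !mxE /=.
have e2 l : (l < 3)%N -> (inord l == Ordinal (isT : (2 < 3)%N) :> 'I_3) = (l == 2%N).
  by move=> hl; rewrite -val_eqE /= inordK.
by move: k hk => [|[|[|[|[|[|k]]]]]] // _; rewrite /= ?e2 //=; ring.
Qed.

Lemma h3C_pac n (br : 'rV[R]_n -> 'rV[R]_n -> 'rV[R]_n) :
  two_step br -> lie_iso (@sbr R 5 h3C_rel) br -> partial_auto_cont br.
Proof.
move=> Hbr [f [fl [g fK gK] fb]] F HF.
apply: (@heisenberg_decomp R n br Hbr (f \o of_complex) (to_complex \o g)) => //.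
- by move=> a z w /=; rewrite of_complex_linear fl.
- by move=> z /=; rewrite fK of_complexK.
- by move=> x /=; rewrite to_complexK gK.
- by move=> z w /=; rewrite of_complex_br fb.
Qed.

Lemma model_pac n l m (br : 'rV[R]_m -> 'rV[R]_m -> 'rV[R]_m) :
  (n, l) \in models -> (n, l) != (5, n6_rel) -> two_step br ->
  lie_iso br (@sbr R n l) -> partial_auto_cont br.
Proof.
move=> nl ne Hbr /lie_iso_sym iso.
have [e|ne'] := eqVneq (n, l) (5, h3C_rel).
  by case: e iso => -> ->; apply: h3C_pac.
apply: (good_spanned_pac Hbr); apply: (good_spanned_iso iso).
move: nl; rewrite !inE (negPf ne) (negPf ne') !orbF.
do ! [case/orP]; case/eqP => -> ->; first
  [exact: h3_good | exact: h5_good | exact: l5_good | exact: free3_good | exact: h3h3_good].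
Qed.

End ModelsGood.

(** * Isomorphism invariants *)

Lemma lie_iso_dim_le (R : realType) n m (b : 'rV[R]_n -> 'rV[R]_n -> 'rV[R]_n)
  (b' : 'rV[R]_m -> 'rV[R]_m -> 'rV[R]_m) : lie_iso b b' -> (n <= m)%N.
Proof.
move=> [f [/linear_fun_mulmx[M ->] /bij_inj Minj _]].
have /eqP <- : row_free M.
  by apply: inj_row_free => v vM; apply: Minj; rewrite /= vM mul0mx.
exact: rank_leq_col.
Qed.

Section Invariants.
Variable R : realType.

Section Definitions.
Variables (n : nat) (b : 'rV[R]_n.+1 -> 'rV[R]_n.+1 -> 'rV[R]_n.+1).

Definition has_rank1 := exists x, rank1 b x /\ exists y, b x y <> 0.
Definition has_rank1_pair := exists x y, [/\ rank1 b x, rank1 b y & b x y <> 0].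
(** When the derived algebra is a line, this tells an alternating form of rank at least four from
    one of rank two. *)
Definition has_orthogonal_planes := exists x y u v,
  [/\ b x y <> 0, b u v <> 0, b x u = 0 & b y u = 0].
Definition has_small_centralizer := exists x, forall y, b x y = 0 ->
  exists a, forall w, b (y - a *: x) w = 0.

(* The values 0, ..., 6 stand for [h3_rel], [h5_rel], [l5_rel], [free3_rel],
   [h3h3_rel], [n6_rel] and [h3C_rel]. *)
Definition lie_type : nat :=
  if `[< derived1 b >] then (if `[< has_orthogonal_planes >] then 1 else 0)
  else if `[< has_rank1_pair >] then 4
  else if `[< has_small_centralizer >] then (if `[< has_rank1 >] then 2 else 3)
  else if `[< has_rank1 >] then 5 else 6.
End Definitions.

Section Invariance.
Variables (n m : nat).
Variables (b : 'rV[R]_n.+1 -> 'rV[R]_n.+1 -> 'rV[R]_n.+1).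
Variables (b' : 'rV[R]_m.+1 -> 'rV[R]_m.+1 -> 'rV[R]_m.+1).
Variables (f : 'rV[R]_n.+1 -> 'rV[R]_m.+1) (g : 'rV[R]_m.+1 -> 'rV[R]_n.+1).
Hypothesis fl : forall (a : R) x y, f (a *: x + y) = a *: f x + f y.
Hypotheses (fK : cancel f g) (gK : cancel g f).
Hypothesis fb : forall x y, f (b x y) = b' (f x) (f y).

Let f0 : f 0 = 0.
Proof. by have := fl (-1) 0 0; rewrite scaler0 addr0 scaleN1r addNr. Qed.
Let fZ a x : f (a *: x) = a *: f x.
Proof. by have := fl a x 0; rewrite !addr0 f0 addr0. Qed.
Let fB a x y : f (y - a *: x) = f y - a *: f x.
Proof. by rewrite -scaleNr addrC fl addrC scaleNr. Qed.
Let fb0 x y : b' (f x) (f y) = 0 <-> b x y = 0.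
Proof. by rewrite -fb -f0; split=> [/(can_inj fK)|->]. Qed.
Let fbN x y : b x y <> 0 -> b' (f x) (f y) <> 0.
Proof. by move=> h /fb0. Qed.

Let derived1_f : derived1 b -> derived1 b'.
Proof.
move=> [w hw]; exists (f w) => x y; have [a e] := hw (g x) (g y).
by exists a; rewrite -fZ -e fb !gK.
Qed.
Let rank1_f x : rank1 b x -> rank1 b' (f x).
Proof.
move=> [w hw]; exists (f w) => y; have [a e] := hw (g y).
by exists a; rewrite -fZ -e fb gK.
Qed.
Let has_rank1_f : has_rank1 b -> has_rank1 b'.
Proof.
move=> [x [h [y xy]]]; exists (f x); split; first exact: rank1_f.
by exists (f y); apply: fbN.
Qed.
Let has_rank1_pair_f : has_rank1_pair b -> has_rank1_pair b'.
Proof.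
move=> [x [y [hx hy xy]]]; exists (f x), (f y).
by split; [apply: rank1_f | apply: rank1_f | apply: fbN].
Qed.
Let planes_f : has_orthogonal_planes b -> has_orthogonal_planes b'.
Proof.
move=> [x [y [u [v [h1 h2 h3 h4]]]]]; exists (f x), (f y), (f u), (f v).
by split; [apply: fbN | apply: fbN | apply/fb0 | apply/fb0].
Qed.
Let small_f : has_small_centralizer b -> has_small_centralizer b'.
Proof.
move=> [x hx]; exists (f x) => y e.
have [|a ha] := hx (g y); first by apply/fb0; rewrite gK.
by exists a => w; rewrite -(gK y) -fB -(gK w); apply/fb0.
Qed.
Definition invariants_transport :=
  (derived1_f, has_rank1_f, has_rank1_pair_f, planes_f, small_f).
End Invariance.

Lemma lie_type_iso n m (b : 'rV[R]_n.+1 -> 'rV[R]_n.+1 -> 'rV[R]_n.+1)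
  (b' : 'rV[R]_m.+1 -> 'rV[R]_m.+1 -> 'rV[R]_m.+1) :
  lie_iso b b' -> lie_type b = lie_type b'.
Proof.
move=> iso; have [f [fl [g fK gK] fb]] := iso.
have [f' [fl' [g' fK' gK'] fb']] := lie_iso_sym iso.
have [[[[h1 h2] h3] h4] h5] := invariants_transport fl fK gK fb.
have [[[[k1 k2] k3] k4] k5] := invariants_transport fl' fK' gK' fb'.
rewrite /lie_type (asbool_equiv_eq (conj h1 k1)) (asbool_equiv_eq (conj h2 k2)).
rewrite (asbool_equiv_eq (conj h3 k3)) (asbool_equiv_eq (conj h4 k4)).
by rewrite (asbool_equiv_eq (conj h5 k5)).
Qed.

(** The vanishing of 2 by 2 minors turns the rank conditions into polynomial equations in
    coordinates. *)
Lemma multiple_minor n (w u v : 'rV[R]_n.+1) i j :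
  (exists a, u = a *: w) -> (exists a, v = a *: w) ->
  co u i * co v j = co u j * co v i.
Proof. by move=> [a ->] [c ->]; rewrite !coZ; ring. Qed.

Lemma derived1_minor n (b : 'rV[R]_n.+1 -> 'rV[R]_n.+1 -> 'rV[R]_n.+1) :
  derived1 b -> forall x y x' y' i j,
  co (b x y) i * co (b x' y') j = co (b x y) j * co (b x' y') i.
Proof. by move=> [w hw] x y x' y' i j; apply: multiple_minor (hw _ _) (hw _ _). Qed.

Lemma rank1_minor n (b : 'rV[R]_n.+1 -> 'rV[R]_n.+1 -> 'rV[R]_n.+1) x :
  rank1 b x -> forall y y' i j,
  co (b x y) i * co (b x y') j = co (b x y) j * co (b x y') i.
Proof. by move=> [w hw] y y' i j; apply: multiple_minor (hw _) (hw _). Qed.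

Ltac minor H := have := H; rewrite /sbr !big_cons !big_nil /= ?(coD, coZ, co0, coN)
  ?co_ev //= ?(coD, coZ, co0, coN) ?co_ev //=; try lia.

Lemma pair_rank1 n (b : 'rV[R]_n.+1 -> 'rV[R]_n.+1 -> 'rV[R]_n.+1) :
  has_rank1_pair b -> has_rank1 b.
Proof. by move=> [x [y [h _ xy]]]; exists x; split=> //; exists y. Qed.

Lemma sqr_sum_eq0 (x y : R) : x * x + y * y = 0 -> x = 0 /\ y = 0.
Proof. by move=> h; split; nra. Qed.

Lemma h3_type n : (2 <= n)%N -> lie_type (@sbr R n h3_rel) = 0%N.
Proof.
move=> hn; rewrite /lie_type asboolT; last first.
  by exists (ev R n 2) => x y; rewrite /sbr big_cons big_nil addr0; eexists.
rewrite asboolF // => -[x [y [u [v [xy uv xu yu]]]]].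
sbr_at 2%N xu => e1; sbr_at 2%N yu => e2.
have {}e1 : co x 0 * co u 1 - co x 1 * co u 0 = 0 by lra.
have {}e2 : co y 0 * co u 1 - co y 1 * co u 0 = 0 by lra.
(* Cramer's rule: [u] is orthogonal to [x] and [y], which span everything modulo the center, so [u]
   is central. *)
pose d := co x 0 * co y 1 - co x 1 * co y 0.
have d0 : d != 0.
  by apply/eqP => d0; apply: xy; rewrite /sbr big_cons big_nil /= -/d d0 scale0r addr0.
have u0 : co u 0 = 0.
  apply: (mulfI d0); rewrite mulr0 -(mulr0 (co y 0)) -{1}e1 -(subr0 (_ * (_ - _))).
  by rewrite -(mulr0 (co x 0)) -{1}e2 /d; ring.
have u1 : co u 1 = 0.
  apply: (mulfI d0); rewrite mulr0 -(mulr0 (co y 1)) -{1}e1 -(subr0 (_ * (_ - _))).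
  by rewrite -(mulr0 (co x 1)) -{1}e2 /d; ring.
by apply: uv; rewrite /sbr big_cons big_nil /= u0 u1 !mul0r subrr scale0r addr0.
Qed.

Lemma h5_type n : (4 <= n)%N -> lie_type (@sbr R n h5_rel) = 1%N.
Proof.
move=> hn; rewrite /lie_type asboolT; last first.
  exists (ev R n 4) => x y; rewrite /sbr !big_cons big_nil addr0 -scalerDl /=.
  by eexists.
rewrite asboolT //; exists (ev R n 0), (ev R n 1), (ev R n 2), (ev R n 3).
split; first by move=> e; sbr_at 4%N e; lra.
- by move=> e; sbr_at 4%N e; lra.
- by sbr_zero.
- by sbr_zero.
Qed.

Lemma l5_type n : (4 <= n)%N -> lie_type (@sbr R n l5_rel) = 2%N.
Proof.
move=> hn; have lk : graded n l5_rel 3 by rewrite /graded /=; lia.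
rewrite /lie_type asboolF; last first.
  move=> /derived1_minor h.
  by minor (h (ev R n 0) (ev R n 1) (ev R n 0) (ev R n 2) 3 4)%N; lra.
rewrite asboolF; last first.
  move=> [x [y [/rank1_minor hx /rank1_minor hy]]]; apply.
  have x0 : co x 0 = 0.
    by minor (hx (ev R n 1) (ev R n 2) 3 4)%N => e; nra.
  have y0 : co y 0 = 0.
    by minor (hy (ev R n 1) (ev R n 2) 3 4)%N => e; nra.
  by rewrite /sbr !big_cons big_nil /= x0 y0; apply/rowP => i; rewrite !mxE; ring.
rewrite asboolT; last first.
  exists (ev R n 0) => y e; exists (co y 0) => w; apply: (sbr_low _ lk).
  sbr_at 3%N e => e3; sbr_at 4%N e => e4.
  by move=> [|[|[|i]]] //= _; rewrite coD coN coZ !co_ev //=; try lia; lra.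
rewrite asboolT //; exists (ev R n 1); split.
  exists (ev R n 3) => y; exists (- co y 0).
  by sbr_zero.
by exists (ev R n 0) => e; sbr_at 3%N e; lra.
Qed.

Lemma free3_type : lie_type (@sbr R 5 free3_rel) = 3%N.
Proof.
have lk : graded 5 free3_rel 3 by [].
have nr : ~ has_rank1 (@sbr R 5 free3_rel).
  move=> [x [/rank1_minor hx [y]]]; apply.
  have x0 : co x 0 = 0 by minor (hx (ev R 5 1) (ev R 5 2) 3 4)%N => e; nra.
  have x1 : co x 1 = 0 by minor (hx (ev R 5 0) (ev R 5 2) 3 5)%N => e; nra.
  have x2 : co x 2 = 0 by minor (hx (ev R 5 0) (ev R 5 1) 4 5)%N => e; nra.
  by apply: (sbr_low _ lk) => -[|[|[|i]]].
rewrite /lie_type asboolF; last first.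
  move=> /derived1_minor h.
  by minor (h (ev R 5 0) (ev R 5 1) (ev R 5 0) (ev R 5 2) 3 4)%N; lra.
rewrite asboolF; last by move/pair_rank1.
rewrite asboolT; last first.
  exists (ev R 5 0) => y e; exists (co y 0) => w; apply: (sbr_low _ lk).
  sbr_at 3%N e => e3; sbr_at 4%N e => e4.
  by move=> [|[|[|i]]] //= _; rewrite coD coN coZ !co_ev //=; lra.
by rewrite asboolF.
Qed.

Lemma h3h3_type : lie_type (@sbr R 5 h3h3_rel) = 4%N.
Proof.
rewrite /lie_type asboolF; last first.
  move=> /derived1_minor h.
  by minor (h (ev R 5 0) (ev R 5 1) (ev R 5 2) (ev R 5 3) 4 5)%N; lra.
rewrite asboolT //; exists (ev R 5 0), (ev R 5 1); split.
- exists (ev R 5 4) => y; exists (co y 1); by sbr_zero.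
- exists (ev R 5 4) => y; exists (- co y 0); by sbr_zero.
- by move=> e; sbr_at 4%N e; lra.
Qed.

Lemma n6_type : lie_type (@sbr R 5 n6_rel) = 5%N.
Proof.
rewrite /lie_type asboolF; last first.
  move=> /derived1_minor h.
  by minor (h (ev R 5 0) (ev R 5 1) (ev R 5 0) (ev R 5 2) 4 5)%N; lra.
rewrite asboolF; last first.
  have r1 x : rank1 (@sbr R 5 n6_rel) x -> co x 0 = 0 /\ co x 1 = 0.
    move=> /rank1_minor hx; split.
      by minor (hx (ev R 5 1) (ev R 5 2) 4 5)%N => e; nra.
    by minor (hx (ev R 5 0) (ev R 5 3) 4 5)%N => e; nra.
  move=> [x [y [/r1[x0 x1] /r1[y0 y1]]]]; apply.
  by rewrite n6E x0 x1 y0 y1; apply/rowP => i; rewrite !mxE; ring.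
rewrite asboolF; last first.
  move=> [x hx].
  have cen a (y : 'rV[R]_6) : (forall w, sbr n6_rel (y - a *: x) w = 0) ->
      [/\ co y 0 = a * co x 0, co y 1 = a * co x 1,
          co y 2 = a * co x 2 & co y 3 = a * co x 3].
    by move/n6_central_co; rewrite !coD !coN !coZ => -[h0 h1 h2 h3]; split; lra.
  (* The test vector is eps x modulo the center. It commutes with [x] and is a real multiple of [x]
     only if [x] is itself a multiple of eps; but then X3 and X4 both commute with [x] and cannot
     both be multiples of it. *)
  have [|a /cen[]] := hx (co x 1 *: ev R 5 2 - co x 0 *: ev R 5 3).
    by rewrite n6E !coD !coN !coZ !co_ev //=; apply/rowP => i; rewrite !mxE; ring.
  rewrite !coD !coN !coZ !co_ev //= => a0 a1 a2 a3.
  have {}a0 : a * co x 0 = 0 by lra.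
  have {}a1 : a * co x 1 = 0 by lra.
  have x0 : co x 0 = 0.
    have e : co x 0 = - (a * co x 3) by lra.
    apply/eqP; rewrite -sqrf_eq0 expr2 {1}e.
    by rewrite mulNr mulrAC a0 mul0r oppr0.
  have x1 : co x 1 = 0.
    have e : co x 1 = a * co x 2 by lra.
    by apply/eqP; rewrite -sqrf_eq0 expr2 {1}e mulrAC a1 mul0r.
  have [|c /cen[_ _]] := hx (ev R 5 2).
    by rewrite n6E x0 x1 !co_ev //=; apply/rowP => i; rewrite !mxE; ring.
  rewrite !co_ev //= => c2 c3.
  have [|d /cen[_ _]] := hx (ev R 5 3).
    by rewrite n6E x0 x1 !co_ev //=; apply/rowP => i; rewrite !mxE; ring.
  rewrite !co_ev //= => d2 d3.
  have : (c * co x 2) * (d * co x 3) = (c * co x 3) * (d * co x 2) by ring.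
  by rewrite -c2 -c3 -d2 -d3; lra.
rewrite asboolT //; exists (ev R 5 3); split.
  by exists (ev R 5 5) => y; exists (- co y 1); sbr_zero.
by exists (ev R 5 1) => e; sbr_at 5%N e; lra.
Qed.

Lemma h3C_type : lie_type (@sbr R 5 h3C_rel) = 6%N.
Proof.
have lk : graded 5 h3C_rel 4 by [].
have nr : ~ has_rank1 (@sbr R 5 h3C_rel).
  move=> [x [/rank1_minor hx [y]]]; apply.
  have [x0 x1] : co x 0 = 0 /\ co x 1 = 0.
    apply: sqr_sum_eq0.
    by minor (hx (ev R 5 2) (ev R 5 3) 4 5)%N => e; lra.
  have [x2 x3] : co x 2 = 0 /\ co x 3 = 0.
    apply: sqr_sum_eq0.
    by minor (hx (ev R 5 0) (ev R 5 1) 4 5)%N => e; lra.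
  by apply: (sbr_low _ lk) => -[|[|[|[|i]]]].
rewrite /lie_type asboolF; last first.
  move=> /derived1_minor h.
  by minor (h (ev R 5 0) (ev R 5 2) (ev R 5 0) (ev R 5 3) 4 5)%N; lra.
rewrite asboolF; last by move/pair_rank1.
rewrite asboolF ?asboolF // => -[x hx].
have cen a (y : 'rV[R]_6) : (forall w, sbr h3C_rel (y - a *: x) w = 0) ->
    [/\ co y 0 = a * co x 0, co y 1 = a * co x 1,
        co y 2 = a * co x 2 & co y 3 = a * co x 3].
  move=> h; have h2 := h (ev R 5 2); have h0 := h (ev R 5 0).
  sbr_at 4%N h2 => e0; sbr_at 5%N h2 => e1; sbr_at 4%N h0 => e2; sbr_at 5%N h0 => e3.
  by split; lra.
(* The vector i x commutes with [x], and is a real multiple of it modulo the center only if [x] is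
   central. *)
pose ix := - co x 1 *: ev R 5 0 + co x 0 *: ev R 5 1 - co x 3 *: ev R 5 2
  + co x 2 *: ev R 5 3.
have [|a /cen[]] := hx ix.
  rewrite /sbr !big_cons big_nil /= /ix !(coD, coZ, coN) !co_ev //=.
  by apply/rowP => i; rewrite !mxE; ring.
rewrite /ix !(coD, coZ, coN) !co_ev //= => a0 a1 a2 a3.
have [x0 x1] : co x 0 = 0 /\ co x 1 = 0 by apply: sqr_sum_eq0; nra.
have [x2 x3] : co x 2 = 0 /\ co x 3 = 0 by apply: sqr_sum_eq0; nra.
have [|c /cen[]] := hx (ev R 5 0).
  by apply: (sbr_low _ lk) => -[|[|[|[|i]]]].
by rewrite x0 co_ev //=; lra.
Qed.

Lemma models_not_iso n l m l' : (n, l) \in models -> (m, l') \in models ->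
  lie_iso (@sbr R n l) (@sbr R m l') -> (n, l) = (m, l').
Proof.
move=> hl hl' iso.
have e : n = m.
  apply/eqP; rewrite -eqSS eqn_leq (lie_iso_dim_le iso).
  by rewrite (lie_iso_dim_le (lie_iso_sym iso)).
have := lie_type_iso iso; move: hl hl' {iso}; rewrite -{}e {m} => hl hl'.
(* The list is ordered by the values of [lie_type], so in a given dimension the type recovers the
   relations. *)
have code k : (n, k) \in models -> lie_type (@sbr R n k) =
    index k [:: h3_rel; h5_rel; l5_rel; free3_rel; h3h3_rel; n6_rel; h3C_rel].
  rewrite !inE => h; move: h.
  do ! [case/orP]; case/eqP => -> ->; first
  [exact: h3_type | exact: h5_type | exact: l5_type | exact: free3_type
  | exact: h3h3_type | exact: h3C_type | exact: n6_type].
rewrite !code // => e; congr pair; move: e.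
have sub k : (n, k) \in models ->
    k \in [:: h3_rel; h5_rel; l5_rel; free3_rel; h3h3_rel; n6_rel; h3C_rel].
  by rewrite !inE => h; move: h; do ! [case/orP]; case/eqP => _ ->.
by move=> e; rewrite -(nth_index [::] (sub _ hl)) e nth_index // sub.
Qed.

End Invariants.

Lemma two_step_dim_gt0 (R : realType) n (br : 'rV[R]_n -> 'rV[R]_n -> 'rV[R]_n) :
  two_step br -> (0 < n)%N.
Proof.
by case: n br => // br [_ [x [y xy]] _]; case: xy; apply/rowP => -[].
Qed.

Definition model (R : realType) (i : 'I_12) :
    {n : nat & ('rV[R]_n -> 'rV[R]_n -> 'rV[R]_n)} :=
  let m := nth (0%N, [::]) models i in
  existT (fun n => 'rV[R]_n -> 'rV[R]_n -> 'rV[R]_n) m.1.+1 (@sbr R m.1 m.2).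

Theorem theoremB (R : realType) :
  (* exactly twelve isomorphism classes of 2-step nilpotent Lie algebras
     (equivalently, simply connected 2-step nilpotent Lie groups) of dim <= 6 *)
  (exists cls : 'I_12 -> {n : nat & ('rV[R]_n -> 'rV[R]_n -> 'rV[R]_n)},
     [/\ (forall i, (projT1 (cls i) <= 6)%N /\ two_step (projT2 (cls i))),
         (forall i j, lie_iso (projT2 (cls i)) (projT2 (cls j)) -> i = j) &
         (forall n (br : 'rV[R]_n -> 'rV[R]_n -> 'rV[R]_n),
            (n <= 6)%N -> two_step br ->
            exists i, lie_iso br (projT2 (cls i)))]) /\
  (* N_6 does not satisfy the partial automatic continuity *)
  ~ partial_auto_cont (@n6_br R) /\
  (* all the others do *)
  (forall n (br : 'rV[R]_n -> 'rV[R]_n -> 'rV[R]_n),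
     (n <= 6)%N -> two_step br -> ~ lie_iso br (@n6_br R) ->
     partial_auto_cont br).
Proof.
have mem (i : 'I_12) : nth (0%N, [::]) models i \in models by apply: mem_nth.
split; last split; last first.
- move=> n br n6 Hbr niso; have n0 := two_step_dim_gt0 Hbr.
  move: n0 br n6 Hbr niso; case: n => // n _ br n6 Hbr niso.
  have [l [hl iso]] := classification n6 Hbr.
  apply: (model_pac hl _ Hbr iso); apply/eqP => -[e el]; apply: niso.
  by subst n l; rewrite n6_brE.
- exact: n6_not_pac.
exists (@model R); split.
- move=> i; have h := mem i; rewrite /model /=; split.
    have /allP/(_ _ h) : all (fun m => m.1 <= 5)%N models by [].
    by [].
  by apply: models_two_step; rewrite -surjective_pairing.
- move=> i j; rewrite /model /= => /models_not_iso.
  rewrite -!surjective_pairing => /(_ (mem i) (mem j)) /eqP.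
  by rewrite nth_uniq // => /eqP /val_inj.
- move=> n br n6 Hbr; have n0 := two_step_dim_gt0 Hbr.
  move: n0 br n6 Hbr; case: n => // n _ br n6 Hbr.
  have [l [hl iso]] := classification n6 Hbr.
  have hi : (index (n, l) models < 12)%N by rewrite -[12%N]/(size models) index_mem.
  exists (Ordinal hi); rewrite /model /=.
  have := nth_index (0%N, [::]) hl => e.
  by rewrite -[nth _ _ _]/(nth (0%N, [::]) models (index (n, l) models)) e.
Qed.
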